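(* Let $t \ge 0$ and $n \ge 3$ be integers, let $G$ be a graph, and let $E_1,\ldots,E_{3n-3+t}$ be (possibly empty) sets of edges of $G$ such that the union of any $t+1$ of them contains a matching of size $n$. Then there is a rainbow matching of size $n$, i.e. distinct indices $i_1,\ldots,i_n$ and edges $f_j \in E_{i_j}$ such that $\{f_1,\ldots,f_n\}$ is a matching of size $n$. *)

(* Defs.v *)
From mathcomp Require Import all_boot finmap.
From mathcomp Require Import boolp classical_sets.

Set Implicit Arguments.
Unset Strict Implicit.
Unset Printing Implicit Defensive.

(* Simple graphs, not required to be finite. An edge is the two-element set of
   its ends, so there are no loops and no parallel edges. The vertex type is a
   [choiceType] only so that [{fset V}] is available; classically every type
   carries such a structure. *)
Record graph (V : choiceType) := Graph {
  edges : set {fset V};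
  card_edge : forall e : {fset V}, edges e -> #|` e| = 2
}.

Definition is_matching (V : choiceType) (G : graph V)
    (M : {fset {fset V}}) : Prop :=
  (forall e, e \in M -> edges G e) /\
  (forall e f, e \in M -> f \in M -> e != f -> [disjoint e & f]%fset).

Definition contains_matching (V : choiceType) (G : graph V)
    (F : set {fset V}) (n : nat) : Prop :=
  exists M : {fset {fset V}},
    [/\ is_matching G M, #|` M| = n & forall e, e \in M -> F e].

(* [E] is an indexed family: its members may coincide, so being rainbow asks
   for distinct indices, not for distinct sets [E (i j)]. *)
Definition has_rainbow_matching (V : choiceType) (G : graph V) (N : nat)
    (E : 'I_N -> set {fset V}) (n : nat) : Prop :=
  exists (i : 'I_n -> 'I_N) (f : 'I_n -> {fset V}),
    [/\ injective i,
        forall j, E (i j) (f j),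
        is_matching G [fset f j | j : 'I_n]%fset &
        #|` [fset f j | j : 'I_n]%fset| = n].

(* Main.v *)
(**
  Put [K = n - 1] and suppose that rainbow matchings have at most [K] edges. For a graph [G], let
  [D G] be the set of vertices missed by some maximum matching of [G]. If adding any single edge
  of [F] changes neither the matching number nor [D G], then adding all of [F] does not change
  the matching number. Hence a rainbow [G] with matching number [K] and more than [t] unused
  colours can be enlarged by an unused colour so that [D G] grows; as there are [3K + t] colours,
  this gives [|G| + |V \ D G| >= 3K] for every rainbow [G] with matching number [K].

  This inequality is tight along the greedy process that starts from a rainbow matching of size
  [K], and it forbids odd cycles of length at least 5 (they add too many vertices to [D G] for
  too few colours). So the process only attaches triangles to earlier vertices, and it ends in a
  rainbow [G] with [3K] edges and [D G] everything, built from [K] triangles. In such a [G] the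
  colour of the edge opposite to a vertex [v] of degree 2 must also contain an edge from [v] to
  another component; exchanging colours then shows that the triangles attached last are
  components of [G]. Two triangle components are impossible as well: exchanging their colours
  produces three disjoint rainbow edges between them, in the place of two.
*)

Require Import Defs.
From mathcomp Require Import all_boot finmap.
From mathcomp Require Import boolp zify.

Set Implicit Arguments.
Unset Strict Implicit.
Unset Printing Implicit Defensive.

Ltac use_hyps := repeat match goal with
  | H : is_true (?x != ?y) |- context [?y == ?x] => rewrite (eq_sym y x) (negbTE H)
  | H : is_true (~~ ?b) |- context [?b] => rewrite (negbTE H)
  | H : is_true (?x \in ?A) |- context [?x \in ?A] => rewrite H
  end.
Ltac absurd_hyps := match goal with
  | H : is_true (?x != ?x) |- _ => by rewrite eqxx in H
  | H : is_true (~~ ?b), H' : is_true ?b |- _ => by rewrite H' in H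
  end.
Ltac split_eqs := repeat match goal with
  | |- context [?u == ?x] => is_var u; is_var x; case: (eqVneq u x) => [?|?]; [subst;
    try absurd_hyps|]
  end.
Ltac set_solve := apply/setP => ?; rewrite !inE ?eqxx; use_hyps; split_eqs; use_hyps;
  rewrite ?eqxx /= ?(andbT, andbF, orbT, orbF, negbK) //=;
  repeat match goal with |- context [?x \in ?A] => case: (x \in A) end => //=.
Ltac in_solve := rewrite !inE ?eqxx; use_hyps; split_eqs; use_hyps; 
  rewrite ?eqxx /= ?(andbT, andbF, orbT, orbF, negbK) //=.

(** * Perfectly matched vertex sets *)

Section Matchings.
Variable T : finType.
Implicit Types (G K M : {set {set T}}) (X Y Z S P : {set T}) (u v w x y z : T).

Definition ed x y : {set T} := [set x; y].
Lemma edC x y : ed x y = ed y x. Proof. exact: setUC. Qed.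

Inductive pm G : {set T} -> Prop :=
| pm0 : pm G set0
| pmS x y Y : x \in Y -> y \in Y -> x != y -> ed x y \in G ->
    pm G (Y :\: ed x y) -> pm G Y.

Lemma card_ed x y : x != y -> #|ed x y| = 2.
Proof. by move=> xy; rewrite cards2 xy. Qed.

Lemma cardD_ed x y Y : x \in Y -> y \in Y -> x != y -> #|Y| = #|Y :\: ed x y|.+2.
Proof.
move=> xY yY xy; have := cardsID (ed x y) Y.
have s : ed x y \subset Y by apply/subsetP => u; rewrite !inE => /orP[] /eqP ->.
by rewrite (setIidPr s) card_ed // => <-.
Qed.

Lemma pm_in G G' Y : pm G Y ->
  (forall x y, x \in Y -> y \in Y -> x != y -> ed x y \in G -> ed x y \in G') -> pm G' Y.
Proof.
elim=> {Y} [|x y Y xY yY xy xyG _ IH] H; first exact: pm0.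
apply: (pmS xY yY xy); first exact: H.
by apply: IH => u v; rewrite !inE => /andP[_ uY] /andP[_ vY]; apply: H.
Qed.

Lemma pm_sub G G' Y : G \subset G' -> pm G Y -> pm G' Y.
Proof. by move=> /subsetP s p; apply: pm_in p _ => *; apply: s. Qed.

Lemma pm_even G Y : pm G Y -> ~~ odd #|Y|.
Proof.
by elim=> {Y} [|x y Y xY yY xy _ _ IH]; rewrite ?cards0 // (cardD_ed xY yY xy) /= negbK.
Qed.

Lemma pm_inv G Y x : pm G Y -> x \in Y ->
  exists y, [/\ y \in Y, x != y, ed x y \in G & pm G (Y :\: ed x y)].
Proof.
move=> p; elim: p x => {Y} [|u v Y uY vY uv uvG p IH] x xY; first by rewrite inE in xY.
have [exu|xu] := eqVneq x u; first by subst x; exists v.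
have [exv|xv] := eqVneq x v; first by subst x; exists u; rewrite edC; split => //; rewrite eq_sym.
have [|y [yY xy xyG p']] := IH x; first by in_solve.
move: (yY); rewrite !inE negb_or => /andP[/andP[yu yv] yY'].
exists y; split=> //; apply: (pmS (x := u) (y := v)) => //; try by in_solve.
by rewrite setDDl setUC -setDDl.
Qed.

Lemma pm_add G Y x y : pm G Y -> x != y -> x \notin Y -> y \notin Y ->
  ed x y \in G -> pm G (x |: (y |: Y)).
Proof.
move=> p xy xY yY xyG; apply: (pmS (x := x) (y := y)) => //; try by in_solve.
suff -> : (x |: (y |: Y)) :\: ed x y = Y by [].
set_solve.
Qed.

Lemma pm_cat G Y Z : pm G Y -> pm G Z -> [disjoint Y & Z] -> pm G (Y :|: Z).
Proof.
elim=> {Y} [|x y Y xY yY xy xyG p IH] pZ d; first by rewrite set0U.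
have dx := disjointFr d xY; have dy := disjointFr d yY.
apply: (pmS (x := x) (y := y)) => //; rewrite ?inE ?xY ?yY //.
have -> : (Y :|: Z) :\: ed x y = (Y :\: ed x y) :|: Z.
  apply/setP => u; rewrite !inE; case: eqP => [->|_]; first by rewrite dx.
  by case: eqP => [->|_]; rewrite ?dy.
by apply: IH => //; apply: disjointWl d; apply: subsetDl.
Qed.

Lemma pm_restrict G Y P : pm G Y ->
  (forall u v, u \in Y -> v \in Y -> u != v -> ed u v \in G -> u \in P -> v \in P) ->
  pm G (Y :&: P) /\ pm G (Y :\: P).
Proof.
elim=> {Y} [|x y Y xY yY xy xyG p IH] H; first by rewrite set0I set0D; split; apply: pm0.
have [|p1 p2] := IH.
  by move=> u v; rewrite !inE => /andP[_ uY] /andP[_ vY]; apply: H.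
have [xP|xP] := boolP (x \in P).
  have yP := H _ _ xY yY xy xyG xP.
  split; first by apply: (pmS (x := x) (y := y)); rewrite ?inE ?xY ?yY //; rewrite -setIDAC.
  suff -> : Y :\: P = (Y :\: ed x y) :\: P by [].
  apply/setP => u; rewrite !inE; case: eqP => [->|_]; first by rewrite xP.
  by case: eqP => [->|_]; rewrite ?yP.
have yP : y \notin P.
  by apply/negP => yP; case/negP: xP; apply: (H y x) => //; rewrite 1?eq_sym 1?edC.
split.
  suff -> : Y :&: P = (Y :\: ed x y) :&: P by [].
  apply/setP => u; rewrite !inE; case: eqP => [->|_]; first by rewrite (negbTE xP) andbF.
  by case: eqP => [->|_]; rewrite ?(negbTE yP) ?andbF.
apply: (pmS (x := x) (y := y)); rewrite ?inE ?xY ?yY ?xP ?yP //.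
by rewrite setDDl setUC -setDDl.
Qed.

Lemma ed_inj x y u v : u != v -> ed x y = ed u v -> (x = u /\ y = v) \/ (x = v /\ y = u).
Proof.
move=> uv /setP e.
have := e u; have := e v; rewrite !inE !eqxx orbT /=.
by case/orP=> /eqP ev; case/orP=> /eqP eu; subst; rewrite ?eqxx // in uv *; auto.
Qed.

Lemma pm_matching G Y : pm G Y -> exists M, [/\ M \subset G, pm M Y, #|M|.*2 = #|Y|,
  trivIset M & forall e, e \in M -> #|e| = 2 /\ e \subset Y].
Proof.
elim=> {Y} [|x y Y xY yY xy xyG p [M [sM pM cM tM eM]]].
  exists set0; split; rewrite ?sub0set ?cards0 //; first exact: pm0.
    by apply/trivIsetP => A B; rewrite inE.
  by move=> e; rewrite inE.
have nM : ed x y \notin M.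
  apply/negP => /eM[_ /subsetP/(_ x)]; rewrite !inE eqxx /= => /(_ isT); by [].
exists (ed x y |: M); split.
- by rewrite subUset sub1set xyG.
- apply: (pmS xY yY xy); first by rewrite setU11.
  by apply: pm_sub pM; apply: subsetUr.
- by rewrite cardsU1 nM doubleD cM (cardD_ed xY yY xy).
- apply/trivIsetP => A B; rewrite !inE => /orP[/eqP->|AM] /orP[/eqP->|BM]; rewrite ?eqxx // => AB.
  + have [_ sB] := eM _ BM; rewrite disjoint_sym; apply: disjointWl sB _.
    by rewrite -setI_eq0 -subset0; apply/subsetP => u; rewrite !inE; case: (_ || _);
      rewrite ?andbF.
  + have [_ sA] := eM _ AM; apply: disjointWl sA _.
    by rewrite -setI_eq0 -subset0; apply/subsetP => u; rewrite !inE; case: (_ || _);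
      rewrite ?andbF.
  + by move/trivIsetP: tM => ->.
- move=> e; rewrite !inE => /orP[/eqP->|/eM[c s]].
    by rewrite card_ed //; split=> //; apply/subsetP => u; rewrite !inE => /orP[]/eqP->.
  by split=> //; apply: subset_trans s (subsetDl _ _).
Qed.

Lemma matching_pm G M : M \subset G -> trivIset M -> (forall e, e \in M -> #|e| = 2) ->
  pm G (cover M) /\ #|cover M| = #|M|.*2.
Proof.
move=> sM tM cM; split; last first.
  rewrite -(eqP tM) (eq_bigr (fun=> 2)); last by move=> e /cM.
  by rewrite sum_nat_const muln2.
elim: {M}_.+1 {-2}M (ltnSn #|M|) sM tM cM => // m IH M lM sM tM cM.
have [->|[e eM]] := set_0Vmem M.
  rewrite /cover big_set0; exact: pm0.
have /eqP/cards2P[x [y [xy ee]]] := cM e eM.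
have eC : e \subset cover M by apply: (bigcup_max e).
have xC : x \in cover M by apply: (subsetP eC); rewrite ee !inE eqxx.
have yC : y \in cover M by apply: (subsetP eC); rewrite ee !inE eqxx orbT.
apply: (pmS xC yC xy); first by rewrite /ed -ee; apply: (subsetP sM).
have -> : cover M :\: ed x y = cover (M :\ e).
  have := @trivIsetS _ (M :\ e) M; move: (tM) => /trivIsetP tM' _.
  apply/setP => u; rewrite inE /ed -ee; apply/andP/bigcupP.
    case=> ue /bigcupP[f fM uf]; exists f => //; rewrite !inE fM andbT.
    by apply/eqP => ef; rewrite -ef uf in ue.
  case=> f; rewrite !inE => /andP[fe fM] uf; split; last by apply/bigcupP; exists f.
  by have /disjointFr-> := tM' _ _ fM eM fe.
apply: IH.
- by rewrite (cardsD1 e M) eM in lM.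
- by apply: subset_trans sM; apply: subsetDl.
- by apply: trivIsetS tM; apply: subsetDl.
- by move=> f; rewrite !inE => /andP[_ /cM].
Qed.
End Matchings.

(** * Vertices missed by maximum matchings *)

Section AlternatingPaths.
Variable T : finType.
Implicit Types (G K M : {set {set T}}) (X Y Z S P : {set T}) (u v w x y z : T).

(* [K] is an even path from [y] to [z] with vertex set [S], recorded by the two facts in use:
   it has fewer edges than vertices, and together with the edge [ed y z] it perfectly matches
   [S] minus any vertex. *)
Definition epath K S y z :=
  [/\ y \in S, z \in S, #|K| < #|S|, pm K (S :\ y) /\ pm K (S :\ z) &
   forall s, s \in S -> pm K (S :\ s) \/
     [/\ y != z, s != y, s != z & pm K (S :\: [set s; y; z])]].

Lemma cardU1_le (U : finType) (a : U) (A : {set U}) : #|a |: A| <= #|A|.+1.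
Proof. by rewrite cardsU1; case: (a \notin A). Qed.

Lemma epath_refl z : epath set0 [set z] z z.
Proof.
have e : [set z] :\ z = set0 by apply/setP => u; rewrite !inE; case: eqP.
split; rewrite ?inE ?eqxx ?cards0 ?cards1 // ?e; first by split; apply: pm0.
by move=> s; rewrite inE => /eqP->; left; rewrite e; apply: pm0.
Qed.

Lemma epath_cons K S u v y z : epath K S y z -> u != v -> u \notin S -> v \notin S ->
  epath (ed u v |: (ed v y |: K)) (u |: (v |: S)) u z.
Proof.
move=> [yS zS cK [py pz] H] uv uS vS.
have vy : v != y by apply: contraNneq vS => ->.
have uz : u != z by apply: contraNneq uS => ->.
have uy : u != y by apply: contraNneq uS => ->.
have vz : v != z by apply: contraNneq vS => ->.
have sK : K \subset ed u v |: (ed v y |: K) by rewrite setUA subsetUr.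
have euv : ed u v \in ed u v |: (ed v y |: K) by rewrite !inE eqxx.
have evy : ed v y \in ed u v |: (ed v y |: K) by rewrite !inE eqxx orbT.
have pu : pm (ed u v |: (ed v y |: K)) ((u |: (v |: S)) :\ u).
  apply: (pmS (x := v) (y := y)) => //; try by in_solve.
  suff -> : (u |: (v |: S)) :\ u :\: ed v y = S :\ y by apply: pm_sub py.
  set_solve.
split=> //; try by in_solve.
- rewrite [#|u |: _|]cardsU1 [#|v |: _|]cardsU1 !inE negb_or uv uS vS /=.
  have := cardU1_le (ed u v) (ed v y |: K); have := cardU1_le (ed v y) K.
  by move=> h1 h2; apply: leq_ltn_trans h2 _; rewrite !ltnS; apply: leq_trans h1 cK.
- split=> //; apply: (pmS (x := u) (y := v)) => //; try by in_solve.
  suff -> : (u |: (v |: S)) :\ z :\: ed u v = S :\ z by apply: pm_sub pz.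
  set_solve.
move=> s; rewrite !inE => /orP[/eqP->|/orP[/eqP->|sS]]; first by left.
  right; rewrite uz vz eq_sym uv; split=> //.
  suff -> : (u |: (v |: S)) :\: [set v; u; z] = S :\ z by apply: pm_sub pz.
  set_solve.
have su : s != u by apply: contraNneq uS => <-.
have sv : s != v by apply: contraNneq vS => <-.
case: (H s sS) => [p|[yz sy sz p]]; [left|right].
  apply: (pmS (x := u) (y := v)) => //; try by in_solve.
  suff -> : (u |: (v |: S)) :\ s :\: ed u v = S :\ s by apply: pm_sub p.
  set_solve.
split=> //; apply: (pmS (x := v) (y := y)) => //; try by in_solve.
suff -> : (u |: (v |: S)) :\: [set s; u; z] :\: ed v y = S :\: [set s; y; z] by apply: pm_sub p.
set_solve.
Qed.

Lemma alt_path G X X' z : pm G X -> pm G X' -> z \in X -> z \notin X' ->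
  (exists w, [/\ w \in X, w \notin X', z != w, pm G (X :\: ed z w) & pm G (z |: (w |: X'))]) \/
  (exists w K S, [/\ w \notin X, w \in X', epath K S z w & K \subset G] /\
     [/\ S :\ w \subset X, pm G (X :\: S) &
       5 <= #|S| \/ #|S| = 3 /\ exists v, [/\ ed z v \in G, ed v w \in G &
         S = z |: (v |: [set w])]]).
Proof.
elim: {X}_.+1 {-2}X (ltnSn #|X|) X' z => // m IH X lX X' z p p' zX zX'.
have [v1 [v1X zv1 zv1G p1]] := pm_inv p zX.
have [v1X'|v1X'] := boolP (v1 \in X'); last first.
  by left; exists v1; split=> //; apply: pm_add.
have [v2 [v2X' v12 v12G p1']] := pm_inv p' v1X'.
have zv2 : z != v2 by apply: contraNneq zX' => ->.
have [v2X|v2X] := boolP (v2 \in X); last first.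
  right; exists v2; exists (ed z v1 |: (ed v1 v2 |: set0)), (z |: (v1 |: [set v2])).
  split; split=> //.
  - by apply: epath_cons => //; [apply: epath_refl | in_solve | in_solve].
  - by rewrite !subUset !sub1set zv1G v12G sub0set.
  - apply/subsetP => u; rewrite !inE => /andP[uw /orP[/eqP->//|/orP[/eqP->//|e]]].
    by rewrite e in uw.
  - suff -> : X :\: (z |: (v1 |: [set v2])) = X :\: ed z v1 by [].
    set_solve.
  - right; split; last by exists v1.
    by rewrite !cardsU1 cards1 !inE negb_or zv1 zv2 v12.
have l1 : #|X :\: ed z v1| < m by move: lX; rewrite (cardD_ed zX v1X zv1) !ltnS => /ltnW.
have v2X1 : v2 \in X :\: ed z v1 by in_solve.
have v2X1' : v2 \notin X' :\: ed v1 v2 by rewrite !inE eqxx orbT.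
case: (IH _ l1 _ v2 p1 p1' v2X1 v2X1')
  => [[w [wX wX' v2w pA pB]]|[w [K [S [[wX wX' ep sK] [sS pS H]]]]]]; [left|right].
- move: (wX) (wX'); rewrite !inE !negb_or => /andP[/andP[wz wv1] wX0].
  rewrite wv1 eq_sym v2w /= => wX0'.
  exists w; split=> //; first by rewrite eq_sym.
    apply: (pmS (x := v1) (y := v2)) => //; try by in_solve.
    suff -> : X :\: ed z w :\: ed v1 v2 = X :\: ed z v1 :\: ed v2 w by [].
    set_solve.
  apply: (pmS (x := z) (y := v1)) => //; try by in_solve.
  suff -> : (z |: (w |: X')) :\: ed z v1 = v2 |: (w |: (X' :\: ed v1 v2)) by [].
  set_solve.
- have /subsetP sS' := sS.
  have wv1 : v1 != w by apply: contraTneq wX' => <-; rewrite !inE eqxx.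
  have wX0' : w \in X' by move: wX'; rewrite inE => /andP[].
  have wz : z != w by apply: contraNneq zX' => ->.
  have wX0 : w \notin X by move: wX; rewrite !inE eq_sym (negbTE wz) eq_sym (negbTE wv1).
  have zS : z \notin S.
    by apply/negP => zS; have := sS' z; rewrite !inE zS wz eqxx => /(_ isT).
  have v1S : v1 \notin S.
    by apply/negP => zS'; have := sS' v1; rewrite !inE zS' wv1 eqxx orbT => /(_ isT).
  exists w; exists (ed z v1 |: (ed v1 v2 |: K)), (z |: (v1 |: S)); split; split=> //.
  - exact: epath_cons.
  - by rewrite !subUset !sub1set zv1G v12G.
  - apply/subsetP => u; rewrite !inE => /andP[uw /orP[/eqP->//|/orP[/eqP->//|e]]].
    by have := sS' u; rewrite !inE uw e => /(_ isT) /andP[].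
  - suff -> : X :\: (z |: (v1 |: S)) = X :\: ed z v1 :\: S by [].
    set_solve.
  left; rewrite !cardsU1 !inE negb_or zv1 zS v1S !add1n.
  by case: H => [H|[-> _]]; rewrite ?(leqW (leqW H)).
Qed.

Lemma epath_shift G K S X z w : epath K S z w -> K \subset G -> z \in X -> w \notin X ->
  S :\ w \subset X -> pm G (X :\: S) -> pm G (w |: (X :\ z)).
Proof.
move=> [zS wS _ [pz _] _] sK zX wX /subsetP sS pS.
suff -> : w |: (X :\ z) = (X :\: S) :|: (S :\ z).
  apply: pm_cat pS (pm_sub sK pz) _; apply/pred0P => u /=; rewrite !inE.
  by case: (u \in S); rewrite ?andbF.
have wz : w != z by apply: contraNneq wX => ->.
apply/setP => u; have := sS u; rewrite !inE.
have [->|uw] := eqVneq u w; first by rewrite wS wz.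
have [uS|uS] := boolP (u \in S); first by move=> ->; rewrite ?andbT.
have -> : u != z by apply: contraNneq uS => ->.
by rewrite orbF.
Qed.

Lemma pm_trim (G : {set {set T}}) X m : pm G X -> m.*2 <= #|X| -> exists Y, pm G Y /\ #|Y| = m.*2.
Proof.
elim=> {X} [|x y X xX yX xy xyG p IH] le.
  by exists set0; split; [apply: pm0|move: le; rewrite cards0; case: m].
move: le; rewrite leq_eqVlt => /orP[/eqP->|lt]; first by exists X; split=> //; apply: pmS xyG p.
apply: IH; have := pm_even p; move: lt; rewrite (cardD_ed xX yX xy).
by move: #|_| => a; lia.
Qed.

Definition nu_le G k := forall X, pm G X -> #|X| <= k.*2.
(* For [k] the matching number of [G], [missable] defines the set [D] of the Gallai-Edmonds
   decomposition of [G]. *)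
Definition missable G k u := exists X, [/\ pm G X, #|X| = k.*2 & u \notin X].
Definition missable2 G k u v := exists X, [/\ pm G X, #|X| = k.*2, u \notin X & v \notin X].

Lemma missable2C G k u v : missable2 G k u v -> missable2 G k v u.
Proof. by case=> X [? ? ? ?]; exists X. Qed.

Lemma missable2_l G k u v : missable2 G k u v -> missable G k u.
Proof. by case=> X [? ? ? ?]; exists X. Qed.

Lemma missable2_sub G G' k u v : G \subset G' -> missable2 G k u v -> missable2 G' k u v.
Proof. by move=> s [X [p ? ? ?]]; exists X; split=> //; apply: pm_sub p. Qed.

Lemma missable_sub G G' k u : G \subset G' -> missable G k u -> missable G' k u.
Proof. by move=> s [X [p ? ?]]; exists X; split=> //; apply: pm_sub p. Qed.

Lemma cardU2_notin (A : {set T}) u v : u != v -> u \notin A -> v \notin A ->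
  #|u |: (v |: A)| = #|A|.+2.
Proof. by move=> uv uA vA; rewrite !cardsU1 !inE negb_or uv uA vA. Qed.

Lemma card_shift (A : {set T}) u v : u \in A -> v \notin A -> #|v |: (A :\ u)| = #|A|.
Proof. by move=> uA vA; rewrite cardsU1 !inE (negbTE vA) andbF (cardsD1 u A) uA. Qed.

Lemma edge_not_missable2 G k u v : nu_le G k -> u != v -> ed u v \in G -> ~ missable2 G k u v.
Proof.
move=> cap uv uvG [X [p c uX vX]]; have := cap _ (pm_add p uv uX vX uvG).
by rewrite cardU2_notin // c -doubleS leq_double ltnn.
Qed.

(* Gallai's lemma. *)
Lemma missable2_trans G k u v w : nu_le G k -> missable G k v -> u != w ->
  ~ missable2 G k u v -> ~ missable2 G k v w -> ~ missable2 G k u w.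
Proof.
move=> cap [X' [p' c' vX']] uw uv vw [X [p c uX wX]].
have [vX|vX] := boolP (v \in X); last by apply: uv; exists X.
case: (alt_path p p' vX vX') => [[x [xX xX' vx _ pB]]|[x [K [S [[xX xX' ep sK] [sS pS _]]]]]].
  by have := cap _ pB; rewrite cardU2_notin // c' -doubleS leq_double ltnn.
have pX := epath_shift ep sK vX xX sS pS; have cX := card_shift vX xX.
have vN : v \notin x |: (X :\ v).
  by rewrite !inE eqxx /= orbF; apply: contraNneq xX => <-.
have [xu|xu] := eqVneq x u.
  apply: vw; exists (x |: (X :\ v)); split; rewrite ?cX //.
  by rewrite xu !inE (negbTE wX) andbF orbF eq_sym.
apply: uv; exists (x |: (X :\ v)); split; rewrite ?cX //.
by rewrite !inE (negbTE uX) andbF orbF eq_sym.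
Qed.

Lemma pm_remove G X (A : {set T}) : pm G X ->
  exists X0, [/\ pm G X0, [disjoint X0 & A] & #|X| <= #|X0| + #|A|.*2].
Proof.
move=> p; elim: {A}_.+1 {-2}A (ltnSn #|A|) => // m IH A lA.
have [->|[a aA]] := set_0Vmem A.
  by exists X; split; rewrite ?cards0 ?addn0 // -setI_eq0 setI0.
have cA := cardsD1 a A; rewrite aA add1n in cA.
have [|X0 [p0 d0 c0]] := IH (A :\ a); first by rewrite -ltnS -cA.
have dD (Y : {set T}) : [disjoint Y & A :\ a] -> a \notin Y -> [disjoint Y & A].
  move=> d aY; apply/pred0P => u /=; have [->|ua] := eqVneq u a; first by rewrite (negbTE aY).
  by have /pred0P/(_ u) := d; rewrite /= !inE ua.
have [aX0|aX0] := boolP (a \in X0); last first.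
  exists X0; split; [by []|exact: dD|].
  by rewrite cA doubleS; apply: leq_trans c0 _; rewrite leq_add2l; do 2!apply: leqW.
have [b [bX0 ab abG p1]] := pm_inv p0 aX0.
exists (X0 :\: ed a b); split=> //.
  apply: dD; last by rewrite !inE eqxx.
  by apply: disjointWl d0; apply: subsetDl.
by rewrite cA doubleS !addnS -!addSn -(cardD_ed aX0 bX0 ab).
Qed.

(* The easy direction of the Tutte-Berge formula, with [A] the removed vertices. *)
Lemma berge G X (A Bs : {set T}) (P : T -> {set T}) : pm G X ->
  (forall r, r \in Bs -> odd #|P r|) ->
  (forall r u v, r \in Bs -> u \in P r -> u != v -> ed u v \in G -> v \notin A -> v \in P r) ->
  (forall r r' u, r \in Bs -> r' \in Bs -> u \in P r -> u \in P r' -> r = r') ->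
  (forall r u, r \in Bs -> u \in P r -> u \notin A) ->
  #|X| + #|Bs| <= #|T| + #|A|.
Proof.
move=> p oP clP disP PA; have [X0 [p0 d0 c0]] := pm_remove A p.
have nP r : r \in Bs -> exists u, u \in P r :\: X0.
  move=> rB; apply/set0Pn/negP => /eqP e0.
  have sP : P r \subset X0 by rewrite -setD_eq0 e0.
  have [|pP _] := @pm_restrict T G X0 (P r) p0.
    move=> u v _ vX0 uv uvG uP; apply: (clP r u v) => //.
    by rewrite (disjointFr d0 vX0).
  by have := pm_even pP; rewrite (setIidPr sP) oP.
pose g r := odflt r [pick u in P r :\: X0].
have gP r : r \in Bs -> g r \in P r :\: X0.
  move=> /nP[u uP]; rewrite /g; case: pickP => [v //|/(_ u)]; by rewrite uP.
have gi : {in Bs &, injective g}.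
  move=> r r' rB r'B e; apply: (disP r r' (g r)) => //.
    by have := gP r rB; rewrite inE => /andP[].
  by rewrite e; have := gP r' r'B; rewrite inE => /andP[].
have sg : g @: Bs \subset ~: (X0 :|: A).
  apply/subsetP => _ /imsetP[r rB ->]; have := gP r rB; rewrite !inE => /andP[/negbTE-> uP].
  by rewrite (PA r).
have := subset_leq_card sg; rewrite (card_in_imset gi).
have := cardsC (X0 :|: A); rewrite cardsU (disjoint_setI0 d0) cards0 subn0.
move: #|~: _| #|X| #|X0| #|A| #|Bs| c0 => *; lia.
Qed.

Lemma nu_le_classes G F k X0 X : nu_le G k -> pm G X0 -> #|X0| = k.*2 ->
  (forall u v, u != v -> ed u v \in G :|: F -> missable G k u ->
    missable G k v /\ ~ missable2 G k u v) ->
  pm (G :|: F) X -> #|X| <= k.*2.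
Proof.
move=> cap p0 c0 cl p.
pose P u := [set v | `[< missable G k v /\ (v = u \/ ~ missable2 G k u v) >]].
have inP u v : reflect (missable G k v /\ (v = u \/ ~ missable2 G k u v)) (v \in P u).
  by rewrite inE; apply: asboolP.
have e0 u : u \in ~: X0 -> missable G k u by rewrite inE => uX; exists X0.
have clP r u v : r \in ~: X0 -> u \in P r -> u != v -> ed u v \in G :|: F -> v \in P r.
  move=> /e0 er /inP[eu ru] uv uvG; have [ev nuv] := cl u v uv uvG eu.
  apply/inP; split=> //; have [vr|vr] := eqVneq v r; [by left|right].
  case: ru => [<-//|ru]; apply: (missable2_trans (v := u)) => //.
  by rewrite eq_sym.
suff : #|X| + #|~: X0| <= #|T| + #|set0 : {set T}|.
  by rewrite cards0 addn0 -(cardsC X0) c0 leq_add2r.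
apply: (berge (P := P)) p _ _ _ _.
- move=> r rX; have [|pP _] := @pm_restrict T G X0 (P r) p0.
    move=> u v _ _ uv uvG uP; apply: (clP r u v) => //.
    by rewrite inE uvG.
  have rP : r \in P r by apply/inP; split; [apply: e0|left].
  suff eP : X0 :&: P r = P r :\ r.
    by have := pm_even pP; rewrite eP (cardsD1 r (P r)) rP /=.
  apply/setP => u; rewrite !in_setI in_setD1; have [->|ur] := eqVneq u r.
    by rewrite inE in rX; rewrite (negbTE rX).
  case uP: (u \in P r); rewrite ?andbF ?andbT //=.
  case: (boolP (u \in X0)) => // uX; case/inP: uP => _ [|[]]; first by move/eqP: ur.
  by exists X0; split=> //; rewrite inE in rX.
- by move=> r u v rX uP uv uvG _; apply: clP uvG.
- move=> r r' u rX r'X /inP[eu ru] /inP[_ r'u].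
  have [//|rr'] := eqVneq r r'.
  have : missable2 G k r r' by rewrite !inE in rX r'X; exists X0.
  case: ru r'u => [->|ru] [er|r'u] e2 //; first by case: (r'u (missable2C e2)).
    by case: ru; rewrite er.
  exfalso; move: e2; apply: (missable2_trans (v := u)) => //.
  by move=> /missable2C.
- by move=> r u _ _; rewrite inE.
Qed.

Definition del_vertex G (a : T) := [set e in G | a \notin e].

Lemma del_vertexP G a X : pm (del_vertex G a) X <-> pm G X /\ a \notin X.
Proof.
split=> [p|[p aX]].
  split; first by apply: pm_in p _ => x y _ _ _; rewrite inE => /andP[].
  by apply/negP => /(pm_inv p)[y [_ _]]; rewrite !inE eqxx andbF.
apply: pm_in p _ => x y xX yX _ xyG; rewrite !inE xyG negb_or /=.
by apply/andP; split; apply: contraNneq aX => ->.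
Qed.

Lemma pm_cap_lt G k X : pm G X -> #|X| <= k.+1.*2 -> #|X| <> k.+1.*2 -> #|X| <= k.*2.
Proof. by move=> /pm_even; move: #|X| => n; lia. Qed.

Definition unmissable G k := [set v | `[< ~ missable G k v >]].

(* Induction on the number of vertices outside [D]: the statement is inherited when a vertex
   [a] outside [D] that is adjacent to [D] is deleted, and without such a vertex the classes of
   [~ missable2] are closed under adjacency, so that parity bounds every matching. *)
Lemma nu_growth G (F : {set {set T}}) k : nu_le G k -> (exists X, pm G X /\ #|X| = k.*2) ->
  (forall e, e \in F -> nu_le (e |: G) k /\ forall v, missable (e |: G) k v -> missable G k v) ->
  nu_le (G :|: F) k.
Proof.
elim: {G k}_.+1 {-2}G {-2}k (ltnSn #|unmissable G k|) F => // m IH G k lm F cap [X0 [p0 c0]] HF.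
have [[a [d [na ed_ ad adG]]]|nA] := pselect (exists a d,
  [/\ ~ missable G k a, missable G k d, d != a & ed d a \in G :|: F]); last first.
  move=> X pX; apply: (nu_le_classes (G := G) (F := F) (X0 := X0)) => // u v uv uvG eu.
  have ev : missable G k v.
    by apply: contrapT => nv; apply: nA; exists v, u.
  split=> // e2; move: uvG; rewrite inE => /orP[uvG|uvF]; first exact: edge_not_missable2 e2.
  have [cap' _] := HF _ uvF.
  apply: (edge_not_missable2 cap' uv (setU11 _ _)); apply: missable2_sub e2; exact: subsetUr.
have aX X : pm G X -> #|X| = k.*2 -> a \in X.
  by move=> p c; apply/negPn/negP => aX; apply: na; exists X.
have {d ed_ ad adG} [d [Xd [pd cd dXd ad adG]]] : exists d Xd,
    [/\ pm G Xd, #|Xd| = k.*2, d \notin Xd, d != a & ed a d \in G].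
  have [X [p c dX]] := ed_; move: adG; rewrite inE edC => /orP[adG|adF].
    by exists d, X.
  have [b [bX ab abG p1]] := pm_inv p (aX X p c).
  have [_ /(_ b) []] := HF _ adF.
    exists (a |: (d |: (X :\: ed a b))); split.
    - by apply: pm_add; [apply: pm_sub p1; apply: subsetUr|rewrite eq_sym|
        in_solve|in_solve|apply: setU11].
    - rewrite cardU2_notin -?(cardD_ed (aX X p c) bX ab) //;
        [by rewrite eq_sym|in_solve|in_solve].
    - have bd : b != d by apply: contraNneq dX => <-.
      by rewrite !inE eqxx orbT /= (negbTE bd) eq_sym (negbTE ab).
  by move=> Xb [pb cb bXb]; exists b, Xb; split; rewrite // eq_sym.
have [k' ek] : exists k', k = k'.+1.
  have := aX _ pd cd; rewrite (cardsD1 a) in cd => aXd; rewrite aXd in cd.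
  by case: (k) cd => // k' _; exists k'.
subst k.
have G'up u : missable G k'.+1 u -> missable (del_vertex G a) k' u.
  case=> X [p c uX]; have aX' := aX X p c; have [b [bX ab abG p1]] := pm_inv p aX'.
  exists (X :\: ed a b); split; last by rewrite !inE (negbTE uX) andbF.
    by apply/del_vertexP; split=> //; rewrite !inE eqxx.
  by move: c; rewrite (cardD_ed aX' bX ab) doubleS => -[].
have G'a : missable (del_vertex G a) k' a.
  have aX' := aX _ pd cd; have [b [bX ab abG p1]] := pm_inv pd aX'.
  exists (Xd :\: ed a b); split; last by rewrite !inE eqxx.
    by apply/del_vertexP; split=> //; rewrite !inE eqxx.
  by move: cd; rewrite (cardD_ed aX' bX ab) doubleS => -[].
have small G1 X : pm (del_vertex G1 a) X -> nu_le G1 k'.+1 -> (missable G1 k'.+1 a -> False) ->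
  #|X| <= k'.*2.
  move=> /del_vertexP[p aX'] cap1 na1; apply: (pm_cap_lt p (cap1 _ p)) => c.
  by apply: na1; exists X.
have delU G1 (G2 : {set {set T}}) : del_vertex (G1 :|: G2) a = del_vertex G1 a :|: del_vertex G2
  a.
  by apply/setP => e; rewrite !inE andb_orl.
suff capD : nu_le (del_vertex (G :|: F) a) k'.
  move=> X pX; have [aX'|aX'] := boolP (a \in X).
    have [b [bX ab abG p1]] := pm_inv pX aX'.
    rewrite (cardD_ed aX' bX ab) doubleS !ltnS; apply: capD; apply/del_vertexP; split=> //.
    by rewrite !inE eqxx.
  apply: leq_trans (capD X _) _; first by apply/del_vertexP.
  by rewrite leq_double.
rewrite delU; apply: IH.
- have s : unmissable (del_vertex G a) k' \subset unmissable G k'.+1 :\ a.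
    apply/subsetP => u; rewrite !inE => /asboolP nu; apply/andP; split.
      by apply: contra_notN nu => /eqP->.
    by apply/asboolP => /G'up.
  have aN : a \in unmissable G k'.+1 by rewrite inE; apply/asboolP.
  have := subset_leq_card s; rewrite -ltnS.
  have := cardsD1 a (unmissable G k'.+1); rewrite aN add1n => <- h; exact: leq_trans h lm.
- by move=> X p; apply: small p cap na.
- have [X [p c _]] := G'a; by exists X.
move=> e; rewrite inE => /andP[eF ae]; have [cape De] := HF e eF.
have eD : e |: del_vertex G a = del_vertex (e |: G) a.
  by rewrite delU; congr (_ :|: _); apply/setP => f; rewrite !inE; case: eqP => // ->.
rewrite eD; split; first by move=> X p; apply: small p cape (fun h => na (De _ h)).
move=> v [X [/del_vertexP[p aX'] c vX]]; have [->|va] := eqVneq v a; first exact: G'a.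
apply: G'up.
have [vXd|vXd] := boolP (v \in Xd); last by exists Xd.
have pd' : pm (e |: G) Xd by apply: pm_sub pd; apply: subsetUr.
case: (alt_path pd' p vXd vX) => [[w [wXd wX vw pA pB]]|[w [K [S [[wX wX' ep sK] [sS pS _]]]]]].
  have [wa|wa] := eqVneq w a.
    subst w; apply: De; exists (a |: (d |: (Xd :\: ed v a))).
    have dv : d != v by apply: contraNneq dXd => ->.
    split.
    - apply: pm_add => //; try by [in_solve|rewrite eq_sym|rewrite inE adG orbT].
    - rewrite cardU2_notin ?[a == d]eq_sym //; try by in_solve.
      by rewrite -(cardD_ed vXd wXd vw).
    by rewrite !inE (negbTE va) eqxx [v == d]eq_sym (negbTE dv).
  exfalso; apply: na; apply: De; exists (v |: (w |: X)); split=> //.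
    by rewrite cardU2_notin // c doubleS.
  by rewrite !inE !negb_or [a == v]eq_sym va [a == w]eq_sym wa aX'.
apply: De; exists (w |: (Xd :\ v)); split.
- exact: epath_shift ep sK vXd wX sS pS.
- by rewrite card_shift.
- by rewrite !inE eqxx /= orbF; apply: contraNneq wX => <-.
Qed.
End AlternatingPaths.

(** * Rainbow graphs *)

Section Rainbow.
Variables (T C : finType) (E : C -> {set {set T}}) (K t : nat).
Implicit Types (G M : {set {set T}}) (X Y Z S P : {set T}) (u v w x y z : T) (c : C).
Hypothesis K_gt1 : 1 < K.
Hypothesis card_colours : #|C| = 3 * K + t.
Hypothesis coop : forall I : {set C}, t < #|I| ->
  exists X, pm (\bigcup_(c in I) E c) X /\ #|X| = K.+1.*2.

Definition rainbow_by (col : {set T} -> C) G :=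
  {in G &, injective col} /\ forall e, e \in G -> e \in E (col e).
Definition rainbow G := exists col, rainbow_by col G.
Definition recol (col : {set T} -> C) e c f := if f == e then c else col f.

Lemma rainbow_by_sub col G G' : G \subset G' -> rainbow_by col G' -> rainbow_by col G.
Proof.
move=> /subsetP s [ci ce]; split=> [e f eG fG|e eG]; last by apply: ce; apply: s.
by apply: ci; apply: s.
Qed.

Lemma rainbow_sub G G' : G \subset G' -> rainbow G' -> rainbow G.
Proof. by move=> s [col r]; exists col; apply: rainbow_by_sub r. Qed.

Lemma rainbow_by_recol col G e c : rainbow_by col G -> c \notin col @: (G :\ e) -> e \in E c ->
  rainbow_by (recol col e c) (e |: G).
Proof.
move=> [ci ce] cG eE; rewrite /recol.
have nc f : f \in G -> f != e -> col f != c.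
  by move=> fG fe; apply: contraNneq cG => <-; apply: imset_f; rewrite !inE fe.
split=> [f g|f]; rewrite !inE; last first.
  by case: eqP => [-> //|_] /= fG; apply: ce.
case: (eqVneq f e) => [->|fe]; case: (eqVneq g e) => [->|ge] //= fG gG.
- by move/esym/eqP; rewrite (negbTE (nc _ gG ge)).
- by move/eqP; rewrite (negbTE (nc _ fG fe)).
- exact: ci.
Qed.

Lemma rainbow_by_add col G e c : rainbow_by col G -> c \notin col @: G -> e \in E c ->
  rainbow_by (recol col e c) (e |: G).
Proof.
move=> r cG; apply: rainbow_by_recol => //; apply: contra cG; apply/subsetP.
by apply: imsetS; apply: subsetDl.
Qed.

Lemma card_unused col G : rainbow_by col G -> #|~: (col @: G)| + #|G| = 3 * K + t.
Proof. by move=> [ci _]; rewrite -card_colours -(cardsC (col @: G)) (card_in_imset ci) addnC. Qed.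

Lemma unmissable_sub G k X0 : pm G X0 -> #|X0| = k.*2 -> unmissable G k \subset X0.
Proof.
move=> p c; apply/subsetP => v; rewrite inE => /asboolP nv.
by apply/negPn/negP => vX; apply: nv; exists X0.
Qed.

(* While more than [t] colours are unused, they contain a larger matching, so by [nu_growth] one
   of their edges enlarges the set of missable vertices. *)
Lemma rainbow_card_ge j G : j <= K -> (forall G', rainbow G' -> nu_le G' j) -> rainbow G ->
  (exists X, pm G X /\ #|X| = j.*2) -> 3 * K <= #|G| + #|unmissable G j|.
Proof.
move=> jK cap; elim: {G}_.+1 {-2}G (ltnSn #|unmissable G j|) => // m IH G lm rG exX.
rewrite leqNgt; apply/negP => lt.
have [col rc] := rG.
have [|X [pX cX]] := coop (I := ~: (col @: G)).
  by have := card_unused rc; move: lt; move: #|G| #|unmissable G j| #|~: _|; clear; lia.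
set F := \bigcup_(c in _) E c in pX.
have ncap : ~ nu_le (G :|: F) j.
  move=> /(_ X); rewrite cX leq_double ltnNge jK => h; suff: false by []. 
  by apply: h; apply: pm_sub pX; apply: subsetUr.
apply: ncap; apply: nu_growth => //; first exact: cap.
move=> e /bigcupP[c cI eE]; rewrite inE in cI.
have re : rainbow (e |: G) by exists (recol col e c); apply: rainbow_by_add.
split=> [|v ev]; first exact: cap.
apply: contrapT => nv.
have s : unmissable (e |: G) j \subset unmissable G j :\ v.
  apply/subsetP => u; rewrite !inE => /asboolP nu; apply/andP; split.
    by apply: contra_notN nu => /eqP->.
  by apply/asboolP => eu; apply: nu; apply: missable_sub eu; apply: subsetUr.
have vN : v \in unmissable G j by rewrite inE; apply/asboolP.
have c1 := cardsD1 v (unmissable G j); rewrite vN add1n in c1.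
have c2 := subset_leq_card s; have c3 := cardU1_le e G.
have: 3 * K <= #|e |: G| + #|unmissable (e |: G) j|.
  apply: IH => //; first by move: lm; rewrite c1 !ltnS; apply: leq_ltn_trans.
  by have [X0 [p0 c0]] := exX; exists X0; split=> //; apply: pm_sub p0; apply: subsetUr.
move: lt c1 c2 c3; move: #|e |: G| #|G| #|unmissable G j| #|unmissable (e |: G) j| #|unmissable
  G j :\ v|; clear; lia.
Qed.

Lemma exists_rainbow j : j <= K -> exists M X, [/\ rainbow M, pm M X & #|X| = j.*2].
Proof.
elim: j => [|j IH] jK.
  exists set0, set0; split; [|exact: pm0|exact: cards0].
  have [c _] : exists c : C, true.
    have [|X [p cX]] := coop (I := setT); first by rewrite cardsT card_colours; lia.
    have [x xX] : exists x, x \in X by apply/card_gt0P; rewrite cX.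
    by have [y [_ _ /bigcupP[c _ _] _]] := pm_inv p xX; exists c.
  by exists (fun=> c); split=> [? ?|?]; rewrite inE.
apply: contrapT => nj.
have cap G : rainbow G -> nu_le G j.
  move=> rG X p; rewrite leqNgt; apply/negP => lt; apply: nj.
  have [|Y [pY cY]] := pm_trim (m := j.+1) p.
    by have := pm_even p; move: lt; move: #|_| => a; lia.
  by exists G, Y.
have [M [X [rM pM cM]]] := IH (ltnW jK).
have [M' [sM' pM' cM' _ _]] := pm_matching pM.
have := rainbow_card_ge (ltnW jK) cap (rainbow_sub sM' rM) (ex_intro _ X (conj pM' cM)).
have := subset_leq_card (unmissable_sub pM' cM); rewrite cM in cM' *.
by move: cM' jK; move: #|_| #|_| => a b; lia.
Qed.

Hypothesis cap : forall G, rainbow G -> nu_le G K.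

(* The edge [ed y z] closes an odd cycle [S] that is alternating for a maximum matching. If it
   had length 5 or more, then the cycle and the matching outside [S] would contradict
   [rainbow_card_ge]. *)
Lemma common_nbr (G : {set {set T}}) y z : rainbow (ed y z |: G) -> y != z -> missable G K y ->
  missable G K z ->
  exists v R, [/\ ed y v \in G, ed v z \in G, pm G R, #|R|.+2 = K.*2 &
    [/\ y \notin R, v \notin R, z \notin R, y != v & v != z]].
Proof.
move=> rG yz [X [p cX yX]] [X' [p' cX' zX']].
have sG : G \subset ed y z |: G by apply: subsetUr.
have no2 : ~ missable2 G K y z.
  by move=> /(missable2_sub sG); apply: edge_not_missable2 => //; [apply: cap|apply: setU11].
have zX : z \in X by apply/negPn/negP => zX; apply: no2; exists X.
case: (alt_path p p' zX zX') => [[w [_ wX' zw _ pB]]|[w [Kp [S [[wX wX' ep sK] [sS pS H]]]]]].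
  have := cap (rainbow_sub sG rG) pB; rewrite cardU2_notin // cX' -doubleS leq_double ltnn.
  by [].
have ew : w = y.
  apply/eqP/negPn/negP => wy; apply: no2; exists (w |: (X :\ z)); split.
  - exact: epath_shift ep sK zX wX sS pS.
  - by rewrite card_shift.
  - by rewrite !inE eq_sym (negbTE wy) (negbTE yX) andbF.
  - by rewrite !inE eqxx /= orbF; apply: contraNneq zX' => ->.
subst w; have [zS yS cK [pz py] Hs] := ep.
have cXS : #|X :\: S| + #|S| = K.*2.+1.
  rewrite -cX -(cardsID S X) [#|X :&: S| + _]addnC -addnS; congr (_ + _).
  rewrite (cardsD1 y S) yS add1n; congr _.+1; apply: eq_card => u; rewrite !inE.
  have /subsetP/(_ u) := sS; rewrite !inE; case: (eqVneq u y) => [->|_] /=.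
    by rewrite (negbTE yX).
  by case: (u \in S); rewrite ?andbF ?andbT // => ->.
case: H => [c5|[c3 [v [zv vy eS]]]]; last first.
  exists v, (X :\: S); split=> //; rewrite 1?edC //; first by move: cXS;
    rewrite c3 !addnS addn0 => -[].
  have zv3 : z != v by apply: contra_eq_neq c3; rewrite eS => ->; rewrite setUA setUid cards2;
    case: (v == y).
  have vy3 : v != y by apply: contra_eq_neq c3; rewrite eS => ->; rewrite setUid cards2;
    case: (z == y).
  by split; rewrite ?inE ?eS ?inE ?eqxx ?orbT // eq_sym.
exfalso; have [M [sM pM cM _ _]] := pm_matching pS.
set G0 := ed y z |: (Kp :|: M).
have sKM : Kp :|: M \subset G by rewrite subUset sK.
have s0 : G0 \subset ed y z |: G by apply: setUS.
have sK0 : Kp \subset G0 by rewrite /G0 (setUC Kp) setUA subsetUr.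
have sM0 : M \subset G0 by rewrite /G0 setUA subsetUr.
have pcat s : s \in S -> pm G0 (S :\ s) -> pm G0 ((X :\: S) :|: (S :\ s)) /\
    #|(X :\: S) :|: (S :\ s)| = K.*2.
  move=> sS' ps; have d : [disjoint X :\: S & S :\ s].
    by apply/pred0P => u /=; rewrite !inE; case: (u \in S); rewrite ?andbF.
  split; first by apply: pm_cat (pm_sub sM0 pM) ps d.
  rewrite cardsU (disjoint_setI0 d) cards0 subn0.
  by move: cXS; rewrite (cardsD1 s S) sS' add1n addnS => -[].
have un : unmissable G0 K \subset X :\: S.
  apply/subsetP => u; rewrite inE => /asboolP nu; apply/negPn/negP => uXS; apply: nu.
  have [uS|uS] := boolP (u \in S).
    have pu : pm G0 (S :\ u).
      case: (Hs u uS) => [pu|[zy uz uy pu]]; first exact: pm_sub pu.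
      apply: (pmS (x := y) (y := z)); rewrite ?inE ?yS ?zS ?andbT 1?eq_sym ?eqxx //.
      suff -> : S :\ u :\: ed y z = S :\: [set u; z; y] by apply: pm_sub pu.
      by apply/setP => a; rewrite !inE !negb_or; do 3!case: (_ == _).
    have [p1 c1] := pcat u uS pu; exists ((X :\: S) :|: (S :\ u)); split=> //.
    by rewrite !inE uS eqxx.
  have [p1 c1] := pcat y yS (pm_sub sK0 py); exists ((X :\: S) :|: (S :\ y)); split=> //.
  by rewrite in_setU negb_or uXS !inE (negbTE uS) andbF.
have [p1 c1] := pcat y yS (pm_sub sK0 py).
have := rainbow_card_ge (leqnn K) cap (rainbow_sub s0 rG) (ex_intro _ _ (conj p1 c1)).
have := subset_leq_card un; have c2 : #|G0| <= #|Kp| + #|M| + 1.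
  apply: leq_trans (cardU1_le _ _) _; rewrite addn1 ltnS.
  by rewrite cardsU leq_subr.
move: c2 c5 cK cXS cM; move: #|X :\: S| #|S| #|Kp| #|M| #|G0| #|unmissable _ _|; clear; lia.
Qed.

Lemma leaf_edge (G : {set {set T}}) x a b z :
  (forall u, u != a -> ed u a \in G -> u = x \/ u = b) ->
  (forall u, u != b -> ed u b \in G -> u = x \/ u = a) ->
  ed x a \in G -> ed x b \in G -> ed a b \in G -> a != b -> a != z ->
  rainbow (ed a z |: G) -> ~ missable2 G K a z -> missable G K a -> missable G K z ->
    ed a z \in G.
Proof.
move=> Na Nb xa xb ab nab az rG n2 ea ez.
have [<-|xz] := eqVneq x z; first by rewrite edC.
have [<-//|bz] := eqVneq b z.
have cG := cap (rainbow_sub (subsetUr _ _) rG).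
have [v [R [av vz pR cR [aR vR zR nav nvz]]]] := common_nbr rG az ea ez.
rewrite edC in av; rewrite eq_sym in nav; case: (Na v nav av) => ev; subst v; last first.
  have zb : z != b by rewrite eq_sym.
  rewrite edC in vz; case: (Nb z zb vz) => e; subst z; by rewrite eqxx in xz az.
have bR : b \notin R.
  apply/negP => bR; have [q [qR bq bqG _]] := pm_inv pR bR.
  by rewrite edC eq_sym in bq bqG; case: (Nb q bq bqG) => e; subst q; rewrite qR in aR vR.
case: (@edge_not_missable2 T G K x z cG nvz vz).
exists (a |: (b |: R)); split.
- exact: pm_add.
- by rewrite cardU2_notin.
- have xb' : x != b.
    apply/negP => /eqP e; subst x; have zb : z != b by rewrite eq_sym.
    by rewrite edC in vz; case: (Nb z zb vz) => e; subst z; rewrite eqxx in az bz.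
  by rewrite !inE (negbTE nav) (negbTE xb') (negbTE vR).
- by rewrite !inE eq_sym (negbTE az) eq_sym (negbTE bz) (negbTE zR).
Qed.

(** * Rainbow graphs in which every vertex is missable *)

Section Full.
Variable G : {set {set T}}.
Hypotheses (fullG : forall u, missable G K u) (rbG : rainbow G).

Lemma full_matching : exists X, pm G X /\ #|X| = K.*2.
Proof.
have [|X [_ c]] := coop (I := setT).
  by rewrite cardsT card_colours; move: K_gt1; clear; lia.
have [u _] : exists u, u \in X by apply/card_gt0P; rewrite c.
by have [Y [p cY _]] := fullG u; exists Y.
Qed.

Hypothesis cardG : #|G| <= 3 * K.

Let capG : nu_le G K. Proof. exact: cap. Qed.

Lemma no_augment G' col c y z : rainbow_by col G' -> c \notin col @: G' -> ed y z \in E c ->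
  y != z ->
  ~ missable2 G' K y z.
Proof.
move=> r cG' yzc yz e2; have rU := rainbow_by_add r cG' yzc.
apply: (@edge_not_missable2 T (ed y z |: G') K y z) => //.
- by apply: cap; exists (recol col (ed y z) c).
- exact: setU11.
- by apply: missable2_sub e2; apply: subsetUr.
Qed.

Lemma nu_le_full (F : {set {set T}}) : (forall u v, u != v -> ed u v \in F ->
  ~ missable2 G K u v) ->
  nu_le (G :|: F) K.
Proof.
move=> H X p; have [X0 [p0 c0]] := full_matching.
apply: (nu_le_classes (F := F) capG p0 c0) p => u v uv; rewrite inE => /orP[uvG|uvF] _;
  split=> //.
  exact: edge_not_missable2.
exact: H.
Qed.

Lemma crossing (I : {set C}) : t < #|I| ->
  exists c u v, [/\ c \in I, u != v, ed u v \in E c & missable2 G K u v].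
Proof.
move=> tI; have [X [p c]] := coop tI; apply: contrapT => none.
suff: #|X| <= K.*2 by rewrite c leq_double ltnn.
apply: (nu_le_full (F := \bigcup_(c in I) E c)); last by apply: pm_sub p; apply: subsetUr.
move=> u v uv /bigcupP[d dI uvd] e2; apply: none.
by exists d, u, v.
Qed.

Lemma card_free col d : rainbow_by col G -> d \in col @: G -> t < #|d |: ~: (col @: G)|.
Proof.
move=> r dG; rewrite cardsU1 inE negbK dG; have := card_unused r; move: cardG.
by move: #|G| #|~: _|; clear; lia.
Qed.

Lemma ap_trans u v w : u != w -> ~ missable2 G K u v -> ~ missable2 G K v w ->
  ~ missable2 G K u w.
Proof. exact: missable2_trans. Qed.

Lemma ap_edge u v : u != v -> ed u v \in G -> ~ missable2 G K u v.
Proof. exact: edge_not_missable2. Qed.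

Lemma ap_sym u v : ~ missable2 G K u v -> ~ missable2 G K v u.
Proof. by move=> h /missable2C. Qed.

(* A free colour using an edge of G could take it over; the colour released that way
   must then have an edge between two different classes, which augments. *)
Lemma unused_free col l e : rainbow_by col G -> l \notin col @: G -> e \in G -> e \notin E l.
Proof.
move=> r lG eG; apply/negP => el.
have r' : rainbow_by (recol col e l) (e |: G) by apply: rainbow_by_add.
have eqG : e |: G = G by apply/setUidPr; rewrite sub1set.
rewrite eqG in r'.
have dG : col e \in col @: G by apply: imset_f.
have [c [u [v [cI uv uvc e2]]]] := crossing (card_free r dG).
move: cI; rewrite !inE => /orP[/eqP ec|cG]; last exact: no_augment r cG uvc uv e2.
subst c; apply: no_augment r' _ uvc uv e2; apply/imsetP => -[f fG]; rewrite /recol.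
case: eqP => [_ h|fe h]; first by rewrite -h dG in lG.
by apply: fe; case: r => ci _; apply/esym/ci.
Qed.

Definition leaf x a b :=
  [/\ x != a, x != b & a != b] /\ [/\ ed x a \in G, ed x b \in G, ed a b \in G,
   (forall u, u != a -> ed u a \in G -> u = x \/ u = b) &
   (forall u, u != b -> ed u b \in G -> u = x \/ u = a)].

Lemma leafC x a b : leaf x a b -> leaf x b a.
Proof. by case=> [[xa xb ab] [? ? ? ? ?]]; split; split=> //; rewrite 1?eq_sym 1?edC. Qed.

Lemma leaf_avoid x a b y z : leaf x a b -> b != y -> b != z -> missable2 G K y z ->
  missable2 (G :\ ed x a) K y z.
Proof.
case=> [[xa xb ab] [xaG xbG abG Na Nb]] nby bz [X [p c yX zX]].
have avoid Y : a \notin Y \/ x \notin Y -> pm G Y -> pm (G :\ ed x a) Y.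
  move=> H pY; apply: pm_in pY _ => u v uY vY uv uvG; rewrite !inE uvG andbT.
  apply/eqP => /(ed_inj xa)[] [? ?]; subst; by case: H; rewrite ?uY ?vY.
have abG' : ed a b \in G :\ ed x a.
  by rewrite !inE abG andbT; apply/eqP => /(ed_inj xa)[] [? ?]; subst; rewrite eqxx in ab xb xa.
have xbG' : ed x b \in G :\ ed x a.
  by rewrite !inE xbG andbT; apply/eqP => /(ed_inj xa)[] [? ?]; subst; rewrite eqxx in ab xb xa.
have [bX|bX] := boolP (b \in X).
  have [q [qX bq bqG p1]] := pm_inv p bX; exists X; split=> //.
  have qb : q != b by rewrite eq_sym.
  apply: (pmS (x := b) (y := q)) => //; last first.
    apply: avoid p1; rewrite edC in bqG.
    by case: (Nb q qb bqG) => ->; rewrite !inE eqxx ?orbT; auto.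
  by rewrite edC in bqG *; case: (Nb q qb bqG) => ->.
have [aX|aX] := boolP (a \in X); last by exists X; split=> //; apply: avoid p; left.
have [q [qX aq aqG p1]] := pm_inv p aX.
have eq : q = x.
  by rewrite edC eq_sym in aq aqG; case: (Na q aq aqG) => // e; subst q; rewrite qX in bX.
subst q; exists (a |: (b |: (X :\: ed a x))).
have ay : y != a by apply: contraNneq yX => ->.
have az : z != a by apply: contraNneq zX => ->.
split.
- apply: pm_add => //; [|in_solve|in_solve].
  by apply: avoid p1; left; rewrite !inE eqxx.
- by rewrite cardU2_notin -?(cardD_ed aX qX) //; in_solve.
- by rewrite !inE (negbTE ay) eq_sym (negbTE nby) (negbTE yX) andbF.
- by rewrite !inE (negbTE az) eq_sym (negbTE bz) (negbTE zX) andbF.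
Qed.

Lemma leaf_avoid1 x a b y : leaf x a b -> b != y -> missable (G :\ ed x a) K y.
Proof.
move=> l nby; have [X [p c yX]] := fullG y; apply: (@missable2_l T _ K y y).
by apply: (leaf_avoid l nby nby); exists X.
Qed.

Lemma leaf_cross col x a b c y z : leaf x a b -> rainbow_by col (G :\ ed x a) ->
  c \notin col @: (G :\ ed x a) -> ed y z \in E c -> y != z -> missable2 G K y z ->
    b = y \/ b = z.
Proof.
move=> l r cG yzc yz e2; have [->|nby] := eqVneq b y; first by left.
have [->|bz] := eqVneq b z; first by right.
by case: (no_augment r cG yzc yz); apply: leaf_avoid l _ _ e2.
Qed.

Definition span (I : {set C}) := \bigcup_(c in I) E c.

(* The unused colours and the colour [al] of [ed x a] contain a matching of size [K + 1]. Since
   [b] is the only vertex at which [al] can leave a class, exactly one edge [ed b z] of this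
   matching leaves its class, and the others, [Y], miss at most one vertex of each class. *)
Lemma leaf_matching col x a b : leaf x a b -> rainbow_by col G ->
  let al := col (ed x a) in
  exists z Y (F : {set {set T}}), [/\ ed b z \in E al, b != z & missable2 G K b z] /\
   [/\ F \subset span (al |: ~: (col @: G)), (forall u v, u != v -> ed u v \in F ->
     ~ missable2 G K u v),
     pm F Y, b \notin Y & forall p q, p != q -> p \notin Y -> q \notin Y -> missable2 G K p q].
Proof.
move=> l r al; have [[xa xb ab] [xaG xbG abG Na Nb]] := l.
have alG : al \in col @: G by apply: imset_f.
have [X [p cX]] := coop (card_free r alG); rewrite -/(span _) in p.
set I := _ |: _ in p *.
have alG' : al \notin col @: (G :\ ed x a).
  apply/imsetP => -[f]; rewrite !inE => /andP[/eqP fx fG] e; apply: fx.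
  by case: r => ci _; apply/esym/ci.
have r' : rainbow_by col (G :\ ed x a) by apply: rainbow_by_sub r; apply: subsetDl.
have colI u v : u != v -> ed u v \in span I -> missable2 G K u v ->
  ed u v \in E al /\ (b = u \/ b = v).
  move=> uv /bigcupP[c]; rewrite !inE => /orP[/eqP->|cG] uvc e2;
    last by case: (no_augment r cG uvc uv).
  by split=> //; apply: leaf_cross r' alG' uvc uv e2.
set F0 := del_vertex (span I) b.
have apF u v : u != v -> ed u v \in F0 -> ~ missable2 G K u v.
  move=> uv; rewrite !inE negb_or => /andP[uvI /andP[bu bv]] e2.
  by have [_ [] e] := colI u v uv uvI e2; rewrite e eqxx in bu bv.
have more u v : ~ missable2 G K u v -> nu_le (G :|: (ed u v |: F0)) K.
  move=> n2; apply: nu_le_full => u' v' uv'; rewrite in_setU1 => /orP[/eqP e|]; last exact: apF.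
  have [euv|uv] := eqVneq u v.
    subst v; have := card_ed uv'; by rewrite e /ed setUid cards1.
  by case: (ed_inj uv (e)) => -[-> ->] // /missable2C.
have bX : b \in X.
  apply/negPn/negP => bX; have := nu_le_full apF (X := X).
  rewrite cX leq_double ltnn => H; suff: false by [].
  by apply: H; apply: (pm_sub (subsetUr _ _)); apply/del_vertexP.
have [z [zX bz bzI p1]] := pm_inv p bX.
have e2 : missable2 G K b z.
  apply: contrapT => n2; have := more b z n2 X.
  rewrite cX leq_double ltnn => H; suff: false by [].
  apply: H; apply: (pmS bX zX bz); first by rewrite !inE eqxx orbT.
  apply: (pm_sub (G := F0)); first by rewrite setUA subsetUr.
  by apply/del_vertexP; split=> //; rewrite !inE eqxx.
exists z, (X :\: ed b z), F0; split.
  by split=> //; have [] := colI b z bz bzI e2.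
split=> //.
- by apply/subsetP => e; rewrite inE => /andP[].
- by apply/del_vertexP; split=> //; rewrite !inE eqxx.
- by rewrite !inE eqxx.
move=> u v uv uY vY; apply: contrapT => n2.
have := more u v n2 (u |: (v |: (X :\: ed b z))).
rewrite cardU2_notin // -(cardD_ed bX zX bz) cX leq_double ltnn => H; suff: false by [].
apply: H; apply: pm_add => //; last by rewrite !inE eqxx orbT.
apply: (pm_sub (G := F0)); first by rewrite setUA subsetUr.
by apply/del_vertexP; split=> //; rewrite !inE eqxx.
Qed.

Definition class_rest x a b := [set v | [&& `[< ~ missable2 G K a v >], v != x, v != a & v != b]].

Lemma class_restP x a b v : reflect [/\ ~ missable2 G K a v, v != x,
  v != a & v != b] (v \in class_rest x a b).
Proof. by rewrite inE; apply: (iffP and4P) => -[/asboolP ? ? ? ?]; split=> //; apply/asboolP. Qed.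

Lemma class_restC x a b : leaf x a b -> class_rest x b a = class_rest x a b.
Proof.
case=> [[xa xb ab] [_ _ abG _ _]]; have n2 := ap_edge ab abG.
apply/setP => v; apply/class_restP/class_restP => -[h vx v1 v2]; split=> //; apply: ap_trans h;
  by [rewrite eq_sym|apply: ap_sym|].
Qed.

Lemma leaf_rest col x a b : leaf x a b -> rainbow_by col G ->
  let al := col (ed x a) in
  (exists z, [/\ ed b z \in E al, b != z & missable2 G K b z]) /\
  pm (span (al |: ~: (col @: G))) (class_rest x a b).
Proof.
move=> l r al; have [[xa xb ab] [xaG xbG abG Na Nb]] := l.
have [z [Y [F [h [sF apF pY bY two]]]]] := leaf_matching l r.
split; first by exists z.
rewrite -/al in sF; apply: (pm_sub sF).
have alG' : al \notin col @: (G :\ ed x a).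
  apply/imsetP => -[f]; rewrite !inE => /andP[/eqP fx fG] e; apply: fx.
  by case: r => ci _; apply/esym/ci.
have r' : rainbow_by col (G :\ ed x a) by apply: rainbow_by_sub r; apply: subsetDl.
have ba : b != a by rewrite eq_sym.
have nab := ap_edge ab abG.
have cov v : v != b -> ~ missable2 G K b v -> v \in Y.
  move=> vb n2; apply/negPn/negP => vY; apply: n2.
  by apply: two => //; rewrite eq_sym.
have aY : a \in Y by apply: cov => //; apply: ap_sym.
have [q [qY aq aqF p1]] := pm_inv pY aY.
have qx : q = x.
  have [//|qx] := eqVneq q x.
  have bq : b != q by apply: contraNneq bY => ->.
  have rq : rainbow (ed a q |: (G :\ ed x a)).
    have /bigcupP[c cI aqc] := subsetP sF _ aqF.
    exists (recol col (ed a q) c); apply: rainbow_by_add => //.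
    move: cI; rewrite !inE => /orP[/eqP->//|]; apply: contra.
    by apply/subsetP; apply: imsetS; apply: subsetDl.
  have [v [_ [+ + _ _ [_ _ _ av vq]]]] := common_nbr rq aq (leaf_avoid1 l ba) (leaf_avoid1 l bq).
  rewrite !inE => /andP[avx avG] /andP[_ vqG].
  rewrite edC eq_sym in av avG; case: (Na v av avG) => ev; subst v.
    by rewrite edC eqxx in avx.
  rewrite edC eq_sym in vq vqG; case: (Nb q vq vqG) => // e.
  by subst q; rewrite eqxx in aq.
subst q.
have [|p2 _] := @pm_restrict _ F _ (class_rest x a b) p1.
  move=> u v uY vY uv uvF /class_restP[au ux ua ub]; apply/class_restP.
  move: vY; rewrite !inE negb_or => /andP[/andP[va vx] vY].
  have vb : v != b by apply: contraNneq bY => <-.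
  split=> //; apply: (ap_trans (v := u)) => //; first by rewrite eq_sym.
  exact: apF.
suff <- : (Y :\: ed a x) :&: class_rest x a b = class_rest x a b by [].
apply/setIidPr/subsetP => v /class_restP[av vx va vb]; rewrite !inE negb_or va vx /=.
by apply: cov => //; apply: (ap_trans (v := a)) => //; [rewrite eq_sym|apply: ap_sym].
Qed.

(* If the class is larger than the triangle, then an edge [f] of it also has the colour of
   [ed x b]. Giving [f] to that colour releases the former colour of [f], which therefore has an
   edge from [a] to another class, and that edge is augmenting. *)
Lemma leaf_isolated col x a b : leaf x a b -> rainbow_by col G ->
  (forall c u v, u \in class_rest x a b -> v \in class_rest x a b -> u != v -> ed u v \in E c ->
     [\/ c \notin col @: G, c = col (ed x a) | c = col (ed x b)] -> ed u v \in G) ->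
  forall v, v != x -> ed v x \in G -> v = a \/ v = b.
Proof.
move=> l r edges v0 v0x v0xG; have [[xa xb ab] [xaG xbG abG Na Nb]] := l.
have [ev|v0a] := eqVneq v0 a; first by left.
have [ev|v0b] := eqVneq v0 b; first by right.
exfalso.
have [ci ce] := r.
have lC := leafC l.
have fine c : c = col (ed x a) \/ c = col (ed x b) ->
    pm (span (c |: ~: (col @: G))) (class_rest x a b) ->
    pm [set e in G | e \in E c] (class_rest x a b).
  move=> hc p; apply: pm_in p _ => u v uP vP uv /bigcupP[d]; rewrite !inE => dI uvd.
  have uvG : ed u v \in G.
    apply: (edges d) => //; case/orP: dI => [/eqP->|dG]; last by constructor 1.
    by case: hc => ->; [constructor 2|constructor 3].
  rewrite uvG; case/orP: dI => [/eqP <-//|dG].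
  by have := unused_free r dG uvG; rewrite uvd.
have [_ pA] := leaf_rest l r; have {pA}pA := fine _ (or_introl erefl) pA.
have [_ pB] := leaf_rest lC r; rewrite (class_restC l) in pB.
have {fine pB}pB := fine _ (or_intror erefl) pB.
have v0P : v0 \in class_rest x a b.
  apply/class_restP; split=> //; apply: (ap_trans (v := x)); first by rewrite eq_sym.
    by apply: ap_edge; rewrite 1?eq_sym 1?edC.
  by apply: ap_sym; apply: ap_edge.
have [y [yP vy vyB _]] := pm_inv pB v0P.
move: vyB; rewrite inE => /andP[fG fB]; set f := ed v0 y in fG fB.
have fx e : ed x e != f.
  apply/eqP => h; have : x \in f by rewrite -h !inE eqxx.
  by rewrite !inE eq_sym (negbTE v0x); case/class_restP: yP => _; rewrite eq_sym => /negbTE->.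
have neq e e' : e \in G -> e' \in G -> e != e' -> col e != col e'.
  by move=> eG e'G; apply: contra => /eqP/ci-> //.
have G'f e : f |: (G :\ ed x e) = G :\ ed x e.
  by apply/setUidPr; rewrite sub1set !inE fG eq_sym fx.
have dG : col f \in col @: G by apply: imset_f.
have release e : ed x e \in G -> f \in E (col (ed x e)) ->
    rainbow_by (recol col f (col (ed x e))) (G :\ ed x e) /\
    col f \notin recol col f (col (ed x e)) @: (G :\ ed x e).
  move=> eG fe; split.
    rewrite -(G'f e); apply: rainbow_by_recol => //; first by apply: rainbow_by_sub r;
      apply: subsetDl.
    apply/imsetP => -[g]; rewrite !inE => /and3P[_ gx gG] h.
    by move: gx; rewrite (ci _ _ eG gG h) eqxx.
  apply/imsetP => -[g]; rewrite !inE /recol => /andP[_ gG].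
  case: eqP => [_|gf] h; last by apply: gf; apply/esym/ci.
  by have := neq _ _ fG eG; rewrite h eqxx eq_sym fx => /(_ isT).
have [rB dB] := release b xbG fB.
have [c [u [v [cI uv uvc e2]]]] := crossing (card_free r dG).
move: cI; rewrite !inE => /orP[/eqP ec|cG]; last by case: (no_augment r cG uvc uv).
subst c.
have [z [az azd e2z]] : exists z, [/\ a != z, ed a z \in E (col f) & missable2 G K a z].
  case: (leaf_cross lC rB dB uvc uv e2) => e; subst a; first by exists v.
  by exists u; split; [rewrite eq_sym|rewrite edC|apply: missable2C].
have [X [pX cX aX zX]] := e2z.
have [fA|fA] := boolP (f \in E (col (ed x a))).
  have [rA dA] := release a xaG fA.
  apply: (no_augment rA dA azd az); exists X; split=> //.
  apply: pm_in pX _ => u' v' u'X v'X u'v' u'vG; rewrite !inE u'vG andbT.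
  by apply/eqP => /(ed_inj xa)[] [? ?]; subst; rewrite ?u'X ?v'X in aX.
have r' : rainbow_by col (G :\ f) by apply: rainbow_by_sub r; apply: subsetDl.
have d' : col f \notin col @: (G :\ f).
  apply/imsetP => -[g]; rewrite !inE => /andP[/eqP gf gG] h.
  by apply: gf; apply/esym/ci.
apply: (no_augment r' d' azd az); exists X; split=> //.
pose P := [set v | `[< ~ missable2 G K a v >]].
have PE w : reflect (~ missable2 G K a w) (w \in P) by rewrite inE; apply: asboolP.
have sPX : P \subset X.
  by apply/subsetP => w /PE nw; apply/negPn/negP => wX; apply: nw; exists X.
have [|_ pXP] := @pm_restrict _ G X P pX.
  move=> p q pX' qX pq pqG /PE ap; apply/PE; apply: (ap_trans (v := p)) => //.
    by apply: contraNneq aX => ->.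
  exact: ap_edge.
have -> : X = (X :\: P) :|: P.
  apply/setP => w; rewrite in_setU in_setD; case wP: (w \in P); rewrite ?orbF //=.
  exact: (subsetP sPX).
have v0PP : v0 \in P by apply/PE; case/class_restP: v0P.
apply: pm_cat.
- apply: pm_in pXP _ => p q pP qP pq pqG; rewrite !inE pqG andbT; apply/eqP => h.
  have : v0 \in ed p q by rewrite h !inE eqxx.
  rewrite !inE => /orP[] /eqP h'; subst; first by rewrite inE v0PP in pP.
  by rewrite inE v0PP in qP.
- have xP : x \in P by apply/PE; apply: ap_edge; rewrite 1?eq_sym 1?edC.
  have bP : b \in P by apply/PE; apply: ap_edge.
  apply: (pmS xP bP xb); first by rewrite !inE xbG andbT.
  have -> : P :\: ed x b = class_rest x a b.
    apply/setP => w; apply/idP/class_restP.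
      rewrite !inE negb_or => /andP[/andP[wx wb] /asboolP nw]; split=> //.
      by apply/eqP => e; subst w; apply: nw; exists X.
    by case=> nw wx wa wb; rewrite !inE negb_or wx wb; apply/asboolP.
  apply: pm_in pA _ => p q _ _ _; rewrite !inE => /andP[-> pqA]; rewrite andbT.
  by apply: contraNneq fA => <-.
- by apply/pred0P => w /=; rewrite !inE andbAC andNb.
Qed.

Definition iso x a b := leaf x a b /\ forall u, u != x -> ed u x \in G -> u = a \/ u = b.

Lemma iso_rot x a b : iso x a b -> iso a b x.
Proof.
case=> [[[xa xb ab] [xaG xbG abG Na Nb]] Nx].
split; last by move=> u ua uaG; case: (Na u ua uaG); auto.
split; first by split; rewrite // eq_sym.
split=> //; try by rewrite edC.
by move=> u ub ubG; case: (Nb u ub ubG); auto.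
Qed.

Lemma iso_swap x a b : iso x a b -> iso x b a.
Proof.
case=> l Nx; split; first exact: leafC.
by move=> u ux uxG; case: (Nx u ux uxG); auto.
Qed.

Lemma iso_class x a b v : iso x a b -> v \notin [set x; a; b] -> missable2 G K x v.
Proof.
move=> i; rewrite !inE !negb_or => /andP[/andP[vx va] vb].
have [X [p c vX]] := fullG v.
have [xX|xX] := boolP (x \in X); last by exists X.
have [q [qX xq xqG p1]] := pm_inv p xX.
have {a b i va vb} [o [[[xq' xo qo] [_ _ qoG _ No]] vo]] : exists o, leaf x q o /\ v != o.
  have [l Nx] := i; have qx : q != x by rewrite eq_sym.
  rewrite edC in xqG; case: (Nx q qx xqG) => ->; first by exists b.
  by exists a; split=> //; apply: leafC.
have oX : o \notin X.
  apply/negP => oX; have o1 : o \in X :\: ed x q.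
    by rewrite !inE oX negb_or eq_sym xo eq_sym qo.
  have [r [rX or orG _]] := pm_inv p1 o1.
  by rewrite edC eq_sym in or orG; case: (No r or orG) => e; subst r;
    rewrite !inE eqxx ?orbT in rX.
exists (q |: (o |: (X :\: ed x q))).
have vq : v != q by apply: contraNneq vX => ->.
split.
- by apply: pm_add => //; in_solve.
- by rewrite cardU2_notin -?(cardD_ed xX qX) //; in_solve.
- by in_solve.
- by rewrite !inE (negbTE vq) (negbTE vo) (negbTE vX) andbF.
Qed.

Lemma iso_closed x a b u v : iso x a b -> u != v -> ed u v \in G ->
  u \in [set x; a; b] -> v \in [set x; a; b].
Proof.
case=> [[_ [_ _ _ Na Nb]] Nx] uv uvG; rewrite edC eq_sym in uv uvG.
rewrite !inE => /orP[/orP[]|] /eqP e; subst u.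
- by case: (Nx v uv uvG) => ->; rewrite eqxx ?orbT.
- by case: (Na v uv uvG) => ->; rewrite eqxx ?orbT.
- by case: (Nb v uv uvG) => ->; rewrite eqxx ?orbT.
Qed.

Lemma iso_small x a b X : iso x a b -> pm G X -> #|X :&: [set x; a; b]| <= 2.
Proof.
move=> i p; have [|pi _] := @pm_restrict _ G X [set x; a; b] p.
  by move=> u v _ _; apply: iso_closed.
have := pm_even pi; have : #|X :&: [set x; a; b]| <= 3.
  apply: leq_trans (subset_leq_card (subsetIr _ _)) _.
  have [[[xa xb ab] _] _] := i.
  by rewrite setUC cardsU1 cards2 xa !inE negb_or eq_sym xb eq_sym ab.
by case: #|_| => [|[|[|[|]]]].
Qed.

Definition link col v v' v'' w := ed v w \in E (col (ed v' v'')) /\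
  forall y, v != y -> ed v y \in E (col (ed v' v'')) -> missable2 G K v y -> y = w.

Lemma triangle_link col v1 v2 v3 w1 w2 w3 : rainbow_by col G -> iso v1 v2 v3 -> iso w1 w2 w3 ->
  [disjoint [set v1; v2; v3] & [set w1; w2; w3]] ->
  [\/ link col v1 v2 v3 w1, link col v2 v3 v1 w1 | link col v3 v1 v2 w1].
Proof.
move=> r i1 j dj; have [ci ce] := r.
have i2 := iso_rot i1; have i3 := iso_rot i2.
have [jl _] := iso_rot j; set d := col (ed w2 w3).
have [z [Y [F [_ [sF apF pY _ two]]]]] := leaf_matching jl r; rewrite -/d in sF.
have wG : ed w2 w3 \in G by case: jl => _ [].
have step v v' v'' : iso v v' v'' -> v != w1 -> ed v' v'' != ed w2 w3 ->
    ed v' v'' \in F -> link col v v' v'' w1.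
  move=> i vw ne vF.
  have [[_ [_ _ vG _ _]] _] := i.
  have vd : ed v' v'' \in E d.
    have /bigcupP[c] := subsetP sF _ vF; rewrite !inE => /orP[/eqP->//|cG] vc.
    by have := unused_free r cG vG; rewrite vc.
  set c := col (ed v' v'').
  have [il _] := iso_rot i.
  have uniq y : v != y -> ed v y \in E c -> missable2 G K v y -> y = w1.
    move=> vy vyc e2; apply/eqP; rewrite eq_sym; apply/negPn/negP => wy.
    set G' := G :\ ed w2 w3.
    have eG : ed v' v'' |: G' = G' by apply/setUidPr; rewrite sub1set !inE ne.
    apply: (@no_augment G' (recol col (ed v' v'') d) c v y) => //.
    - rewrite -eG; apply: rainbow_by_recol => //; first by apply: rainbow_by_sub r;
        apply: subsetDl.
      apply/imsetP => -[g]; rewrite !inE => /and3P[_ gw gG] /(ci _ _ wG gG) h.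
      by rewrite h eqxx in gw.
    - apply/imsetP => -[g]; rewrite !inE /recol => /andP[gw gG].
      case: eqP => [_ /(ci _ _ vG wG) h|ng /(ci _ _ vG gG) h]; last by apply: ng.
      by rewrite h eqxx in ne.
    - by apply: leaf_avoid jl _ _ e2 => //; rewrite eq_sym.
  have [z' [_ [_ [[zc vz e2] _]]]] := leaf_matching il r.
  by split=> //; rewrite -(uniq z' vz zc e2).
have nw v : v \in [set v1; v2; v3] -> v \notin [set w1; w2; w3].
  by move=> h; rewrite (disjointFr dj h).
have n1 : v1 \notin [set w1; w2; w3] by apply: nw; rewrite !inE eqxx.
have n2 : v2 \notin [set w1; w2; w3] by apply: nw; rewrite !inE eqxx orbT.
have n3 : v3 \notin [set w1; w2; w3] by apply: nw; rewrite !inE eqxx orbT.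
have nw1 v : v \notin [set w1; w2; w3] -> v != w1.
  by apply: contraNneq => ->; rewrite !inE eqxx.
have ne v v' : v \notin [set w1; w2; w3] -> ed v v' != ed w2 w3.
  apply: contraNneq => h; have : v \in ed w2 w3 by rewrite -h !inE eqxx.
  by rewrite !inE -orbA => ->; rewrite orbT.
have partner v v' v'' : iso v v' v'' -> v \in Y ->
    exists2 q, q \in Y & (q = v' \/ q = v'') /\ ed v q \in F.
  move=> i vY; have [q [qY vq vqF _]] := pm_inv pY vY; exists q => //; split=> //.
  have : q \in [set v; v'; v''].
    by apply/negPn/negP => /(iso_class i); apply: apF.
  by rewrite !inE eq_sym (negbTE vq) /= => /orP[] /eqP->; auto.
have [v1Y|v1Y] := boolP (v1 \in Y).
  have [q _ [[->|->] qF]] := partner _ _ _ i1 v1Y.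
    by constructor 3; apply: step => //; [apply: nw1|apply: ne].
  by constructor 2; apply: step => //; [apply: nw1|apply: ne|rewrite edC].
have [[[v12 _ _] [v12G _ _ _ _]] _] := i1.
have v2Y : v2 \in Y.
  apply/negPn/negP => v2Y; apply: (ap_edge v12 v12G); exact: two.
have [q qY [[->|e] qF]] := partner _ _ _ i2 v2Y.
  by constructor 1; apply: step => //; [apply: nw1|apply: ne].
by rewrite e (negbTE v1Y) in qY.
Qed.

Lemma recol_img col e c G' d : d \notin c |: col @: G' -> d \notin recol col e c @: (e |: G').
Proof.
rewrite !inE negb_or => /andP[dc dG]; apply/imsetP => -[g]; rewrite !inE /recol.
by case: eqP => /= [_ _ h|_ gG h]; [rewrite h eqxx in dc|rewrite h imset_f in dG].
Qed.

Lemma three_links col v1 v2 v3 w1 w2 w3 : rainbow_by col G -> iso v1 v2 v3 -> iso w1 w2 w3 ->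
  [disjoint [set v1; v2; v3] & [set w1; w2; w3]] ->
  ed v1 w1 \in E (col (ed v2 v3)) -> ed v2 w2 \in E (col (ed v3 v1)) ->
  ed v3 w3 \in E (col (ed v1 v2)) -> False.
Proof.
move=> r i j dj e1 e2 e3; have [ci ce] := r.
have [[[v12 v13 v23] [v12G v13G v23G _ _]] _] := i.
have [[[w12 w13 w23] _] _] := j.
pose S1 := [set v1; v2; v3]; pose S2 := [set w1; w2; w3].
have inS q : (q \in S1 :|: S2) = (q \in S1) || (q \in S2) by rewrite in_setU.
pose Gr := [set e in G | [disjoint e & S1 :|: S2]].
have [X [p cX]] := full_matching.
have [|_ p1] := @pm_restrict _ G X (S1 :|: S2) p.
  move=> u v _ _ uv uvG; rewrite !inS => /orP[uS|uS]; apply/orP; [left|right].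
    exact: (iso_closed i uv uvG uS).
  exact: (iso_closed j uv uvG uS).
set Y := X :\: _ in p1.
have pY : pm Gr Y.
  apply: pm_in p1 _ => u v; rewrite !in_setD => /andP[uS _] /andP[vS _] _ uvG.
  rewrite inE uvG; apply/pred0P => q /=; apply/negP; rewrite in_set2 => /andP[/orP[] /eqP->].
    by rewrite (negbTE uS).
  by rewrite (negbTE vS).
have cY : K.*2 <= #|Y| + 4.
  rewrite -cX -(cardsID (S1 :|: S2) X) addnC leq_add2l setIUr.
  apply: leq_trans (leq_card_setU _ _) _.
  exact: leq_add (iso_small i p) (iso_small j p).
have rG : rainbow_by col Gr by apply: rainbow_by_sub r; apply/subsetP => e;
  rewrite inE => /andP[].
have nGr u v : u \in S1 -> ed u v \in G -> col (ed u v) \notin col @: Gr.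
  move=> uS uvG; apply/imsetP => -[g]; rewrite inE => /andP[gG dg] /(ci _ _ uvG gG) h.
  by have := disjointFl dg (_ : u \in S1 :|: S2); rewrite -h inS uS !inE eqxx => /(_ isT).
have s1 : v1 \in S1 by rewrite !inE eqxx.
have s2 : v2 \in S1 by rewrite !inE eqxx orbT.
have s3 : v3 \in S1 by rewrite !inE eqxx orbT.
have v31G : ed v3 v1 \in G by rewrite edC.
have c12 : col (ed v3 v1) != col (ed v2 v3).
  apply/eqP => /(ci _ _ v31G v23G) /(ed_inj v23)[] [h h']; subst; by rewrite eqxx in v12 v13 v23.
have c13 : col (ed v1 v2) != col (ed v2 v3).
  apply/eqP => /(ci _ _ v12G v23G) /(ed_inj v23)[] [h h']; subst; by rewrite eqxx in v12 v13 v23.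
have c23 : col (ed v1 v2) != col (ed v3 v1).
  have v31 : v3 != v1 by rewrite eq_sym.
  apply/eqP => /(ci _ _ v12G v31G) /(ed_inj v31)[] [h h']; subst; by rewrite eqxx in v12 v13 v23.
have r1 := rainbow_by_add rG (nGr _ _ s2 v23G) e1.
have c2 : col (ed v3 v1) \notin col (ed v2 v3) |: col @: Gr.
  by rewrite !inE negb_or c12; apply: nGr.
have r2 := rainbow_by_add r1 (recol_img _ c2) e2.
have c3 : col (ed v1 v2) \notin col (ed v2 v3) |: col @: Gr.
  by rewrite !inE negb_or c13; apply: nGr.
have c3' : col (ed v1 v2) \notin col (ed v3 v1) |:
    recol col (ed v1 w1) (col (ed v2 v3)) @: (ed v1 w1 |: Gr).
  by rewrite in_setU1 negb_or c23; apply: recol_img.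
have r3 := rainbow_by_add r2 (recol_img _ c3') e3.
have dv v w : v \in S1 -> w \in S2 -> v != w.
  by move=> vS; apply: contraTneq => <-; rewrite (disjointFr dj vS).
have u1 : w1 \in S2 by rewrite !inE eqxx.
have u2 : w2 \in S2 by rewrite !inE eqxx orbT.
have u3 : w3 \in S2 by rewrite !inE eqxx orbT.
have nY1 v : v \in S1 -> v \notin Y by move=> vS; rewrite !in_setD inS vS.
have nY2 v : v \in S2 -> v \notin Y by move=> vS; rewrite !in_setD inS vS orbT.
have q1 := pm_add (pm_sub (subsetUr _ _) pY) (dv _ _ s1 u1) (nY1 _ s1) (nY2 _ u1) (setU11 (ed v1
  w1) _).
have [q2 z2] : pm (ed v2 w2 |: (ed v1 w1 |: Gr)) (v2 |: (w2 |: (v1 |: (w1 |: Y)))) /\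
    #|v2 |: (w2 |: (v1 |: (w1 |: Y)))| = #|Y|.+4.
  have h1 : v2 \notin v1 |: (w1 |: Y).
    by rewrite !in_setU1 !negb_or eq_sym v12 (dv _ _ s2 u1) nY1.
  have h2 : w2 \notin v1 |: (w1 |: Y).
    by rewrite !in_setU1 !negb_or [w2 == v1]eq_sym (dv _ _ s1 u2) eq_sym w12 nY2.
  split; first by apply: pm_add (setU11 _ _) => //; [apply: pm_sub q1; apply: subsetUr|apply: dv].
  rewrite (cardU2_notin (dv _ _ s2 u2) h1 h2).
  by rewrite (cardU2_notin (dv _ _ s1 u1) (nY1 _ s1) (nY2 _ u1)).
have h1 : v3 \notin v2 |: (w2 |: (v1 |: (w1 |: Y))).
  rewrite !in_setU1 !negb_or [v3 == v2]eq_sym v23 [v3 == v1]eq_sym v13.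
  by rewrite (dv _ _ s3 u1) (dv _ _ s3 u2) nY1.
have h2 : w3 \notin v2 |: (w2 |: (v1 |: (w1 |: Y))).
  rewrite !in_setU1 !negb_or [w3 == w2]eq_sym w23 [w3 == w1]eq_sym w13.
  by rewrite ![w3 == _]eq_sym (dv _ _ s1 u3) (dv _ _ s2 u3) nY2.
have q3 := pm_add (pm_sub (subsetUr _ _) q2) (dv _ _ s3 u3) h1 h2 (setU11 (ed v3 w3) _).
have rb3 : rainbow (ed v3 w3 |: (ed v2 w2 |: (ed v1 w1 |: Gr))) by eexists; exact: r3.
have := cap rb3 q3; rewrite (cardU2_notin (dv _ _ s3 u3) h1 h2) z2.
by move: cY; move: #|Y|; clear; lia.
Qed.

Lemma link_inj col v v' v'' w w' : iso v v' v'' -> w' \notin [set v; v'; v''] ->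
  link col v v' v'' w -> link col v v' v'' w' -> w' = w.
Proof.
move=> i nw [_ H] [h _]; apply: H => //; last exact: iso_class i nw.
by apply: contraNneq nw => <-; rewrite !inE eqxx.
Qed.

Lemma two_triangles col v1 v2 v3 w1 w2 w3 : rainbow_by col G -> iso v1 v2 v3 -> iso w1 w2 w3 ->
  [disjoint [set v1; v2; v3] & [set w1; w2; w3]] -> False.
Proof.
move=> r i1 j1 dj; have i2 := iso_rot i1; have i3 := iso_rot i2.
have j2 := iso_rot j1; have j3 := iso_rot j2.
have rot (a b c : T) : [set b; c; a] = [set a; b; c] by rewrite setUC setUA.
have swap (a b c : T) : [set a; c; b] = [set a; b; c] by rewrite -!setUA (setUC [set c]).
have [[[w12 w13 w23] _] _] := j1.
have nV w : w \in [set w1; w2; w3] -> w \notin [set v1; v2; v3] by move=> h;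
  rewrite (disjointFl dj h).
have n1 : w1 \notin [set v1; v2; v3] by apply: nV; rewrite !inE eqxx.
have n2 : w2 \notin [set v1; v2; v3] by apply: nV; rewrite !inE eqxx orbT.
have n3 : w3 \notin [set v1; v2; v3] by apply: nV; rewrite !inE eqxx orbT.
have l1 := triangle_link r i1 j1 dj.
have l2 : [\/ link col v1 v2 v3 w2, link col v2 v3 v1 w2 | link col v3 v1 v2 w2].
  by apply: triangle_link j2 _ => //; rewrite (rot w1).
have l3 : [\/ link col v1 v2 v3 w3, link col v2 v3 v1 w3 | link col v3 v1 v2 w3].
  by apply: triangle_link j3 _ => //; rewrite -(rot w3).
have inj v v' v'' w w' : iso v v' v'' -> [set v; v'; v''] = [set v1; v2; v3] ->
    w' \notin [set v1; v2; v3] -> w != w' -> link col v v' v'' w -> link col v v' v'' w' -> False.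
  by move=> i e nw ww lw lw'; rewrite -e in nw; rewrite (link_inj i nw lw lw') eqxx in ww.
have e2 : [set v2; v3; v1] = [set v1; v2; v3] := rot v1 v2 v3.
have e3 : [set v3; v1; v2] = [set v1; v2; v3] := esym (rot v3 v1 v2).
have fin (a b c : T) : iso a b c -> [set a; b; c] = [set w1; w2; w3] ->
    link col v1 v2 v3 a -> link col v2 v3 v1 b -> link col v3 v1 v2 c -> False.
  by move=> j e [la _] [lb _] [lc _]; apply: (three_links r i1 j _ la lb lc); rewrite e.
case: l1 l2 l3 => [l1|l1|l1] [l2|l2|l2] [l3|l3|l3];
  first [ exact: (inj _ _ _ _ _ i1 erefl n2 w12 l1 l2) | exact: (inj _ _ _ _ _ i2 e2 n2 w12 l1 l2)
        | exact: (inj _ _ _ _ _ i3 e3 n2 w12 l1 l2) | exact: (inj _ _ _ _ _ i1 erefl n3 w13 l1 l3)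
        | exact: (inj _ _ _ _ _ i2 e2 n3 w13 l1 l3) | exact: (inj _ _ _ _ _ i3 e3 n3 w13 l1 l3)
        | exact: (inj _ _ _ _ _ i1 erefl n3 w23 l2 l3) | exact: (inj _ _ _ _ _ i2 e2 n3 w23 l2 l3)
        | exact: (inj _ _ _ _ _ i3 e3 n3 w23 l2 l3) | idtac ].
- exact: fin j1 erefl l1 l2 l3.
- exact: fin (iso_swap j1) (swap _ _ _) l1 l3 l2.
- exact: fin (iso_swap j2) (etrans (swap _ _ _) (rot _ _ _)) l2 l1 l3.
- exact: fin j3 (esym (rot _ _ _)) l3 l1 l2.
- exact: fin j2 (rot _ _ _) l2 l3 l1.
- exact: fin (iso_swap j3) (etrans (swap _ _ _) (esym (rot _ _ _))) l3 l2 l1.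
Qed.
End Full.

(** * Forests of triangles *)

Section Forest.
Variables (M : {set {set T}}) (XM : {set T}).
Hypotheses (pmM : pm M XM) (cXM : #|XM| = K.*2) (cM : #|M| = K).
Hypothesis MX : forall u v, u != v -> ed u v \in M -> u \in XM.
Hypothesis mate : forall u v w, u != v -> u != w -> ed u v \in M -> ed u w \in M -> v = w.

Let item : Type := (T * T * T * bool)%type.
Implicit Type s : seq item.

(* An item [(x, a, b, f)] attaches the edge [ed a b] of the matching [M] to the vertex [x] by
   the edge [ed x a], and by [ed x b] as well if [f] holds, which completes a triangle. The most
   recent item comes first. In Gallai-Edmonds terms, [outer], [inner] and [untouched] are the
   sets D, A and C of [fedges s]; [root s v] names the component of [v] in D. *)
Fixpoint fedges s : {set {set T}} :=
  if s is (x, a, b, f) :: s' then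
    if f then ed x b |: (ed x a |: fedges s') else ed x a |: fedges s'
  else M.
Fixpoint outer s : {set T} :=
  if s is (x, a, b, f) :: s' then if f then a |: (b |: outer s') else b |: outer s' else ~: XM.
Fixpoint untouched s : {set T} :=
  if s is (x, a, b, f) :: s' then untouched s' :\: ed a b else XM.
Fixpoint inner s : {set T} :=
  if s is (x, a, b, f) :: s' then if f then inner s' else a |: inner s' else set0.
Fixpoint reps s : {set T} :=
  if s is (x, a, b, f) :: s' then if f then reps s' else b |: reps s' else ~: XM.
Fixpoint root s v : T :=
  if s is (x, a, b, f) :: s' then
    if f && ((v == a) || (v == b)) then root s' x else root s' v
  else v.
Fixpoint forest s : bool :=
  if s is (x, a, b, f) :: s' then
    [&& forest s', ed a b \in M, a != b, a \in untouched s', b \in untouched s' & x \in outer s']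
  else true.

Lemma forest_parts s : forest s -> forall u,
  (u \in outer s) + (u \in untouched s) + (u \in inner s) = 1.
Proof.
elim: s => [_ u|[[[x a] b] f] s IH /= /and5P[w _ ab aO /andP[bO _]] u].
  by rewrite /= !inE; case: (u \in XM).
have := IH w u; have := IH w a; have := IH w b; rewrite aO bO.
case: f; rewrite /= !inE; case: (eqVneq u a) => [->|ua] /=; rewrite ?aO ?bO ?(negbTE ab) /=;
  try (case: (eqVneq u b) => [->|ub] /=; rewrite ?bO //=);
  by do ?[case: (_ \in _)] => //=.
Qed.

Lemma outer_untouched s u : forest s -> u \in outer s -> u \notin untouched s.
Proof. by move=> /forest_parts/(_ u) + h; rewrite h; case: (_ \in untouched s). Qed.
Lemma outer_inner s u : forest s -> u \in outer s -> u \notin inner s.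
Proof. by move=> /forest_parts/(_ u) + h; rewrite h; case: (_ \in untouched s);
  case: (_ \in inner s). Qed.
Lemma inner_untouched s u : forest s -> u \in inner s -> u \notin untouched s.
Proof. by move=> /forest_parts/(_ u) + h; rewrite h; case: (_ \in untouched s);
  case: (_ \in outer s). Qed.
Lemma in_inner s u : forest s -> u \notin outer s -> u \notin untouched s -> u \in inner s.
Proof. by move=> /forest_parts/(_ u) + h h'; rewrite (negbTE h) (negbTE h');
  case: (_ \in inner s). Qed.

Lemma MXr u v : u != v -> ed u v \in M -> v \in XM.
Proof. by rewrite eq_sym edC; apply: MX. Qed.

Lemma fedges_consP x a b (f : bool) s e : reflect
  [\/ e = ed x a, f /\ e = ed x b | e \in fedges s] (e \in fedges ((x, a, b, f) :: s)).
Proof.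
apply: (iffP idP) => /=; case: f; rewrite !inE.
- by case/orP=> [/eqP->|/orP[/eqP->|]]; [constructor 2|constructor 1|constructor 3].
- by case/orP=> [/eqP->|]; [constructor 1|constructor 3].
- by case=> [->|[_ ->]|->]; rewrite ?eqxx ?orbT.
- by case=> [->|[]|->]; rewrite ?eqxx ?orbT.
Qed.

Lemma fedges_sub x a b f s : fedges s \subset fedges ((x, a, b, f) :: s).
Proof. by apply/subsetP => e es; apply/fedges_consP; constructor 3. Qed.

Lemma M_sub s : M \subset fedges s.
Proof.
elim: s => [|[[[x a] b] f] s IH]; first exact: subxx.
exact: subset_trans IH (fedges_sub _ _ _ _ _).
Qed.

Lemma untouched_edge s u v : forest s -> u \in untouched s -> u != v -> ed u v \in fedges s ->
  ed u v \in M /\ v \in untouched s.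
Proof.
elim: s => [_ uX uv uvM|[[[x a] b] f] s IH /= /and5P[w abM ab aO /andP[bO xD]]].
  by split=> //; apply: MXr uvM.
rewrite !inE negb_or => /andP[/andP[ua ub] uO] uv /fedges_consP uvG.
have ux : u != x by apply: contraTneq xD => <-; apply/negP => /(outer_untouched w); rewrite uO.
have {uvG} uvG : ed u v \in fedges s.
  case: uvG => // [H|[_ H]].
    have xa : x != a by apply: contraTneq xD => ->; apply/negP => /(outer_untouched w);
      rewrite aO.
    by case: (ed_inj xa H) => -[e _]; rewrite e eqxx in ux ua.
  have xb : x != b by apply: contraTneq xD => ->; apply/negP => /(outer_untouched w); rewrite bO.
  by case: (ed_inj xb H) => -[e _]; rewrite e eqxx in ux ub.
have [uvM vO] := IH w uO uv uvG; split=> //; rewrite vO andbT negb_or.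
apply/andP; split; apply/eqP => e; subst v.
  case/eqP: ub; apply: (mate (u := a)) => //; first by rewrite eq_sym.
  by rewrite edC.
case/eqP: ua; apply: (mate (u := b)); rewrite 1?eq_sym 1?edC //.
Qed.

Lemma missable_outer s y : forest s -> rainbow (fedges s) -> y \in outer s ->
  missable (fedges s) K y.
Proof.
elim: s y => [y _ _|[[[x a] b] f] s IH y /= /and5P[w abM ab aO /andP[bO xD]] rG].
  by rewrite inE => yX; exists XM.
have rs := rainbow_sub (fedges_sub x a b f s) rG.
have [X [p c xX]] := IH x w rs xD.
have xaG : ed x a \in fedges ((x, a, b, f) :: s) by apply/fedges_consP; constructor 1.
have xa : x != a by apply: contraTneq xD => ->; apply/negP => /(outer_untouched w); rewrite aO.
have xb : x != b by apply: contraTneq xD => ->; apply/negP => /(outer_untouched w); rewrite bO.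
have abG : ed a b \in fedges s by apply: (subsetP (M_sub s)).
have over Y u v : pm (fedges ((x, a, b, f) :: s)) Y -> #|Y| = K.*2 -> u != v ->
    ed u v \in fedges ((x, a, b, f) :: s) -> u \notin Y -> v \in Y.
  move=> pY cY uv uvG uY; apply/negPn/negP => vY.
  by apply: (edge_not_missable2 (cap rG) uv uvG); exists Y.
have pX : pm (fedges ((x, a, b, f) :: s)) X by apply: pm_sub p; exact: fedges_sub.
have aX : a \in X by apply: (over X x a).
have [b' [b'X ab' ab'G p1]] := pm_inv p aX.
have eb : b' = b.
  by have [ab'M _] := untouched_edge w aO ab' ab'G; apply: mate ab'M abM.
subst b'.
have p2 : pm (fedges ((x, a, b, f) :: s)) (X :\: ed a b) by apply: pm_sub p1; exact: fedges_sub.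
have c2 := cardD_ed aX b'X ab; rewrite c in c2.
have eb : missable (fedges ((x, a, b, f) :: s)) K b.
  exists (x |: (a |: (X :\: ed a b))); split.
  - by apply: pm_add => //; in_solve.
  - by rewrite cardU2_notin //; in_solve.
  - by in_solve.
have old : y \in outer s -> missable (fedges ((x, a, b, f) :: s)) K y.
  by move=> yD; apply: missable_sub (fedges_sub _ _ _ _ _) (IH y w rs yD).
case: f rG {xaG over pX p2} eb old => rG eb old; rewrite !inE; last first.
  by case/orP=> [/eqP->|].
case/orP=> [/eqP->|/orP[/eqP->|]] //.
exists (x |: (b |: (X :\: ed a b))); split.
- apply: pm_add; [by apply: pm_sub p1;
    exact: (fedges_sub x a b true s)| |in_solve|in_solve|] => //.
  by rewrite !inE eqxx.
- by rewrite cardU2_notin //; in_solve.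
- by in_solve.
Qed.

Lemma root_untouched s u : forest s -> u \in untouched s -> root s u = u.
Proof.
elim: s => [|[[[x a] b] f] s IH] //= /and5P[w _ _ _ _].
rewrite !inE negb_or => /andP[/andP[/negbTE-> /negbTE->] uO].
by rewrite andbF; apply: IH.
Qed.

Lemma root_reps s u : forest s -> u \in outer s -> root s u \in reps s.
Proof.
elim: s u => [|[[[x a] b] f] s IH] //= u /and5P[w _ ab aO /andP[bO xD]].
case: f; rewrite !inE /=.
  by have [_|ua] := eqVneq u a; have [_|ub] := eqVneq u b => //= uD; apply: IH.
by case/orP=> [/eqP->|uD]; rewrite ?(root_untouched w bO) ?eqxx ?(IH u w uD) ?orbT.
Qed.

Lemma reps_outer s : forest s -> reps s \subset outer s.
Proof.
elim: s => [|[[[x a] b] f] s IH] //= /and5P[w _ ab aO /andP[bO xD]].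
have := IH w; case: f => sub; last exact: setUS.
by apply: subset_trans sub _; rewrite setUA subsetUr.
Qed.

Lemma root_edge s u v : forest s -> u \in outer s -> v \in outer s -> u != v ->
  ed u v \in fedges s -> root s u = root s v.
Proof.
elim: s u v => [u v _|[[[x a] b] f] s IH u v W uD vD uv H].
  by rewrite inE => uX _ uv /(MX uv); rewrite (negbTE uX).
have /= /and5P[w abM ab aO /andP[bO xD]] := W.
have xa : x != a by apply: contraTneq xD => ->; apply/negP => /(outer_untouched w); rewrite aO.
have xb : x != b by apply: contraTneq xD => ->; apply/negP => /(outer_untouched w); rewrite bO.
have aD : a \notin outer s by apply/negP => /(outer_untouched w); rewrite aO.
have bD : b \notin outer s by apply/negP => /(outer_untouched w); rewrite bO.
have matea u' : a != u' -> ed a u' \in fedges s -> u' = b.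
  by move=> au h; have [h' _] := untouched_edge w aO au h; apply: mate h' abM.
have mateb u' : b != u' -> ed b u' \in fedges s -> u' = a.
  move=> bu h; have [h' _] := untouched_edge w bO bu h; apply: mate h' _ => //.
    by rewrite eq_sym.
  by rewrite edC.
move/fedges_consP: H uD vD {W} => H; case: f H => H /=; rewrite !inE => uD vD; last first.
  have ua : u != a by apply: contraTneq uD => ->; rewrite (negbTE ab) aD.
  have va : v != a by apply: contraTneq vD => ->; rewrite (negbTE ab) aD.
  case: H => [/(ed_inj xa)|[]|H] //.
    by case=> -[e1 e2]; rewrite e1 e2 eqxx in ua va.
  have [eu|ub] := eqVneq u b.
    by rewrite eu in H uv; rewrite (mateb v uv H) eqxx in va.
  have [ev|vb] := eqVneq v b.
    by rewrite ev edC eq_sym in H uv; rewrite (mateb u uv H) eqxx in ua.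
  by rewrite (negbTE ub) (negbTE vb) in uD vD; apply: IH.
pose R z := if (z == a) || (z == b) then root s x else root s z.
change (R u = R v).
have Ra : R a = root s x by rewrite /R eqxx.
have Rb : R b = root s x by rewrite /R eqxx orbT.
have Rx : R x = root s x by rewrite /R (negbTE xa) (negbTE xb).
case: H => [/(ed_inj xa)|[_ /(ed_inj xb)]|H].
- by case=> -[-> ->]; rewrite Ra Rx.
- by case=> -[-> ->]; rewrite Rb Rx.
have [eu|ua] := eqVneq u a.
  by rewrite eu in H uv *; rewrite (matea v uv H) Ra Rb.
have [eu|ub] := eqVneq u b.
  by rewrite eu in H uv *; rewrite (mateb v uv H) Ra Rb.
have [ev|va] := eqVneq v a.
  by rewrite ev edC eq_sym in H uv; rewrite (matea u uv H) eqxx in ub.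
have [ev|vb] := eqVneq v b.
  by rewrite ev edC eq_sym in H uv; rewrite (mateb u uv H) eqxx in ua.
rewrite /R (negbTE ua) (negbTE ub) (negbTE va) (negbTE vb).
by rewrite (negbTE ua) (negbTE ub) in uD; rewrite (negbTE va) (negbTE vb) in vD; apply: IH.
Qed.

Lemma inner_edges s v : forest s -> v \in inner s -> exists x b,
  (x, v, b, false) \in s /\ forall u, u != v -> ed u v \in fedges s -> u = x \/ u = b.
Proof.
elim: s => [_|[[[x a] b] f] s IH /= /and5P[w abM ab aO /andP[bO xD]]]; first by rewrite inE.
have xa : x != a by apply: contraTneq xD => ->; apply/negP => /(outer_untouched w); rewrite aO.
have xb : x != b by apply: contraTneq xD => ->; apply/negP => /(outer_untouched w); rewrite bO.
have old : v \in inner s -> exists x0 b0, (x0, v, b0, false) \in (x, a, b, f) :: s /\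
    forall u, u != v -> ed u v \in fedges ((x, a, b, f) :: s) -> u = x0 \/ u = b0.
  move=> vI; have [x0 [b0 [vs H]]] := IH w vI; exists x0, b0.
  have va : v != a by apply: contraTneq vI => ->; apply/negP => /(inner_untouched w); rewrite aO.
  have vb : v != b by apply: contraTneq vI => ->; apply/negP => /(inner_untouched w); rewrite bO.
  have vx : v != x by apply: contraTneq vI => ->; apply: outer_inner.
  split=> [|u uv /fedges_consP]; first by rewrite inE vs orbT.
  case=> [/(ed_inj xa)|[_ /(ed_inj xb)]|]; last exact: H.
    by case=> -[_ e]; rewrite e eqxx in va vx.
  by case=> -[_ e]; rewrite e eqxx in vb vx.
case: f old => //= old; rewrite !inE => /orP[/eqP ev|]; last exact: old.
subst v; exists x, b; split; first by rewrite inE eqxx.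
move=> u ua /(fedges_consP x a b false s)[/(ed_inj xa)|[]|H] //.
  by case=> -[-> e] //; [left|rewrite e eqxx in xa].
right; rewrite edC eq_sym in ua H; have [h _] := untouched_edge w aO ua H.
exact: mate h abM.
Qed.

Lemma odd_class s r : forest s -> r \in reps s -> odd #|[set v in outer s | root s v == r]|.
Proof.
elim: s => [_ rX|[[[x a] b] f] s IH /= /and5P[w abM ab aO /andP[bO xD]]].
  rewrite (_ : [set v in _ | _] = [set r]) ?cards1 //.
  by apply/setP => v; move: rX; rewrite !inE /=; case: (eqVneq v r) => [->|];
    rewrite ?andbF ?andbT.
have aD : a \notin outer s by apply/negP => /(outer_untouched w); rewrite aO.
have bD : b \notin outer s by apply/negP => /(outer_untouched w); rewrite bO.
case: f => /=.
  move=> /(IH w); set Y := [set v in outer s | _] => oY.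
  have [xr|xr] := eqVneq (root s x) r.
    rewrite (_ : [set v in _ | _] = a |: (b |: Y)).
      by rewrite cardU2_notin ?inE ?(negbTE aD) ?(negbTE bD) //= negbK.
    apply/setP => v; rewrite !inE; have [->|va] := eqVneq v a; first by rewrite /= xr eqxx.
    by have [->|vb] := eqVneq v b; first by rewrite /= xr eqxx.
  rewrite (_ : [set v in _ | _] = Y) //; apply/setP => v; rewrite !inE.
  have [->|va] := eqVneq v a; first by rewrite /= (negbTE xr) (negbTE aD).
  by have [->|vb] := eqVneq v b; first by rewrite /= (negbTE xr) (negbTE bD).
have rD u : u \in outer s -> root s u \in outer s.
  by move=> uD; apply: (subsetP (reps_outer w)); apply: root_reps.
rewrite !inE => /orP[/eqP->|rs].
  rewrite (_ : [set v in _ | _] = [set b]) ?cards1 //.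
  apply/setP => v; rewrite !inE; have [->|vb] /= := eqVneq v b;
    first by rewrite root_untouched ?eqxx.
  by apply/negbTE/negP => /andP[/rD + /eqP e]; rewrite e (negbTE bD).
rewrite (_ : [set v in _ | _] = [set v in outer s | root s v == r]); first exact: IH.
apply/setP => v; rewrite !inE; have [->|vb] //= := eqVneq v b.
rewrite (negbTE bD) (root_untouched w bO) /=; apply/negbTE; apply: contraNneq bD => ->.
exact: (subsetP (reps_outer w)).
Qed.

Lemma card_reps s : forest s -> #|reps s| = #|~: XM| + #|inner s|.
Proof.
elim: s => [_|[[[x a] b] f] s IH /= /and5P[w abM ab aO /andP[bO xD]]].
  by rewrite /= cards0 addn0.
case: f => /=; rewrite ?IH // !cardsU1 IH //.
have -> : b \notin reps s.
  by apply/negP => /(subsetP (reps_outer w))/(outer_untouched w); rewrite bO.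
have -> : a \notin inner s by apply/negP => /(inner_untouched w); rewrite aO.
by rewrite /=; lia.
Qed.

Lemma card_fedges s : forest s -> #|fedges s| + #|~: XM| <= #|M| + #|outer s|.
Proof.
elim: s => [_|[[[x a] b] f] s IH /= /and5P[w abM ab aO /andP[bO xD]]] //.
have aD : a \notin outer s by apply/negP => /(outer_untouched w); rewrite aO.
have bD : b \notin outer s by apply/negP => /(outer_untouched w); rewrite bO.
have := IH w; have := cardU1_le (ed x a) (fedges s); case: f => /=.
  rewrite cardU2_notin //; have := cardU1_le (ed x b) (ed x a |: fedges s).
  by move: #|ed x b |: _| #|ed x a |: _| #|fedges s| #|~: XM| #|outer s| #|M|; clear; lia.
rewrite cardsU1 bD.
by move: #|ed x a |: _| #|fedges s| #|~: XM| #|outer s| #|M|; clear; lia.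
Qed.

Lemma forest_fill s1 s2 x a b : forest (s1 ++ (x, a, b, false) :: s2) ->
  let s := s1 ++ (x, a, b, true) :: s2 in
  [/\ forest s, fedges s = ed x b |: fedges (s1 ++ (x, a, b, false) :: s2),
      untouched s = untouched (s1 ++ (x, a, b, false) :: s2) &
      outer s = a |: outer (s1 ++ (x, a, b, false) :: s2)].
Proof.
elim: s1 => [|[[[y c] d] f] s1 IH] //= /and5P[w cdM cd cO /andP[dO yD]].
have [w' -> -> ->] := IH w; split=> //.
- by rewrite w' cdM cd cO dO !inE yD orbT.
- by case: f; apply/setP => e; rewrite !inE; do !case: (_ == _).
- by case: f; apply/setP => e; rewrite !inE; do !case: (_ == _).
Qed.

(* By [berge], the unused colours have an edge from [outer s] to [untouched s] or between two
   components of [outer s]. The former starts a new item; by [common_nbr], the latter completes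
   the triangle of an unfinished item. *)
Lemma forest_grow s : forest s -> rainbow (fedges s) -> outer s != setT ->
  exists s', [/\ forest s', rainbow (fedges s') & #|outer s| < #|outer s'|].
Proof.
move=> w rG dT; have [col rc] := rG.
have [|X [pX cX]] := coop (I := ~: (col @: fedges s)).
  have := card_unused rc; have := card_fedges w; have := cardsC XM.
  have dlt : #|outer s| < #|T| by rewrite -cardsT proper_card // properT.
  move: dlt; rewrite cXM cM.
  by move: #|outer s| #|fedges s| #|~: XM| #|~: (col @: _)| #|T|; clear; lia.
set F := \bigcup_(c in _) E c in pX.
have FG u v : ed u v \in F -> rainbow (ed u v |: fedges s).
  by move=> /bigcupP[c cI eE]; exists (recol col (ed u v) c); apply: rainbow_by_add;
    rewrite // inE in cI *.
have [[u [v [uD uv uvF H]]]|none] := pselect (exists u v, [/\ u \in outer s, u != v,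
  ed u v \in F &
    v \in untouched s \/ v \in outer s /\ root s u != root s v]); last first.
  exfalso; have : #|X| + #|reps s| <= #|T| + #|inner s|.
    apply: (berge (P := fun r => [set v in outer s | root s v == r])) pX _ _ _ _.
    - by move=> r; apply: odd_class.
    - move=> r u v rs; rewrite !inE => /andP[uD /eqP ur] uv uvF vA.
      have vO : v \notin untouched s by apply/negP => vO; apply: none; exists u, v; split=> //;
        left.
      have vD : v \in outer s by apply/negPn/negP => vD; rewrite (in_inner w vD vO) in vA.
      rewrite vD /=; apply/negPn/negP => vr; apply: none; exists u, v; split=> //; right.
      by rewrite ur eq_sym.
    - by move=> r r' u _ _; rewrite !inE => /andP[_ /eqP<-] /andP[_ /eqP<-].
    - by move=> r u _; rewrite inE => /andP[uD _]; apply: outer_inner.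
  rewrite (card_reps w) -(cardsC XM) cX cXM.
  by move: #|~: XM| #|inner s|; clear; lia.
have fresh x : x \in untouched s -> x \notin outer s.
  by move=> xO; apply/negP => /(outer_untouched w); rewrite xO.
case: H => [vO|[vD ruv]].
  have vX : v \in XM.
    elim: s w vO {fresh FG F uvF uv uD X pX cX col rc dT rG} => [|[[[x a] b] f] s IH] //=.
    by move=> /and5P[w _ _ _ _]; rewrite inE => /andP[_ /(IH w)].
  have [v' [_ vv' vv'M _]] := pm_inv pmM vX.
  have [|_ v'O] := untouched_edge w vO vv'; first by apply: (subsetP (M_sub s)).
  exists ((u, v, v', false) :: s); split; rewrite /= ?w ?vv'M ?vv' ?vO ?v'O //.
  - exact: FG.
  - by rewrite cardsU1 (fresh _ v'O).
have [p [R [up pv _ _ [_ _ _ nup npv]]]] :=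
  common_nbr (FG _ _ uvF) uv (missable_outer w rG uD) (missable_outer w rG vD).
have [pD|pD] := boolP (p \in outer s).
  by rewrite (root_edge w uD pD nup up) (root_edge w pD vD npv pv) eqxx in ruv.
have pO : p \notin untouched s.
  apply/negP => pO; rewrite edC eq_sym in up nup.
  by have [_ /fresh] := untouched_edge w pO nup up; rewrite uD.
have [x [b [ps H]]] := inner_edges w (in_inner w pD pO).
have exb : ed u v = ed x b.
  have := H u nup up; have := H v _ _; rewrite edC eq_sym => /(_ npv pv).
  by case=> ev [] eu; subst; rewrite ?eqxx // edC in uv *.
have [s1 [s2 es]] : exists s1 s2, s = s1 ++ (x, p, b, false) :: s2.
  by case/splitPr: ps => s1 s2; exists s1, s2.
subst s.
have [w' eG _ eD] := forest_fill w; exists (s1 ++ (x, p, b, true) :: s2); split=> //.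
  by rewrite eG -exb; apply: FG.
by rewrite eD cardsU1 pD.
Qed.

Lemma full_forest : rainbow M -> exists s, [/\ forest s, rainbow (fedges s) & outer s = setT].
Proof.
move=> rM; suff H m : (exists s, [/\ forest s, rainbow (fedges s) & outer s = setT]) \/
    exists s, [/\ forest s, rainbow (fedges s) & m <= #|outer s|].
  have [//|[s [_ _]]] := H #|T|.+1.
  by rewrite ltnNge max_card.
elim: m => [|m [IH|[s [w rG le]]]]; [by right; exists [::] | by left |].
have [e|ne] := eqVneq (outer s) setT; first by left; exists s.
right; have [s' [w' rG' lt]] := forest_grow w rG ne.
by exists s'; split=> //; apply: leq_ltn_trans lt.
Qed.

Lemma cons_nbr x a b f s : forest ((x, a, b, f) :: s) ->
  (forall u, u != a -> ed u a \in fedges ((x, a, b, f) :: s) -> u = x \/ u = b) /\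
  (forall u, u != b -> ed u b \in fedges ((x, a, b, f) :: s) -> u = x \/ u = a).
Proof.
move=> /= /and5P[w abM ab aO /andP[bO xD]].
have xa : x != a by apply: contraTneq xD => ->; apply/negP => /(outer_untouched w); rewrite aO.
have xb : x != b by apply: contraTneq xD => ->; apply/negP => /(outer_untouched w); rewrite bO.
split=> u ne /fedges_consP[/(ed_inj xa)|[_ /(ed_inj xb)]|].
- by case=> -[-> e]; [left|rewrite e eqxx in xa].
- by case=> -[-> e]; [left|right].
- rewrite edC eq_sym in ne * => h; right.
  by have [h' _] := untouched_edge w aO ne h; apply: mate h' abM.
- by case=> -[-> e]; [left|right].
- by case=> -[-> e]; [left|rewrite e eqxx in xb].
- rewrite edC eq_sym in ne * => h; right.
  have [h' _] := untouched_edge w bO ne h; apply: mate h' _ => //; first by rewrite eq_sym.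
  by rewrite edC.
Qed.

Lemma tower_edge s y z : forest s -> all snd s -> y \in outer s -> z \in outer s -> y != z ->
  rainbow (ed y z |: fedges s) -> ~ missable2 (fedges s) K y z -> ed y z \in fedges s.
Proof.
elim: s y z => [y z _ _|[[[x a] b] f] s IH y z W /= /andP[f1 fs]].
  by rewrite !inE => yX zX yz _ []; exists XM.
rewrite {}f1 {f} in W *; have /= /and5P[w abM ab aO /andP[bO xD]] := W.
move=> yD zD yz rG n2.
have W' : forest ((x, a, b, true) :: s) by [].
have [Na Nb] := cons_nbr W'; rewrite -/(fedges ((x, a, b, true) :: s)) in rG n2 *.
set G := fedges _ in rG n2 Na Nb *.
have rG0 := rainbow_sub (subsetUr _ _) rG.
have ey : missable G K y by apply: missable_outer => //=.
have ez : missable G K z by apply: missable_outer => //=.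
have xaG : ed x a \in G by apply/fedges_consP; constructor 1.
have xbG : ed x b \in G by apply/fedges_consP; constructor 2.
have abG : ed a b \in G by apply: (subsetP (M_sub _)).
have n2' : ~ missable2 G K z y by move=> /missable2C.
have rG' : rainbow (ed z y |: G) by rewrite edC.
have zy : z != y by rewrite eq_sym.
have baG : ed b a \in G by rewrite edC.
have ba : b != a by rewrite eq_sym.
have [eay|ya] := eqVneq y a; first by rewrite eay in yz rG n2 ey *; apply: (leaf_edge Na Nb).
have [eby|yb] := eqVneq y b; first by rewrite eby in yz rG n2 ey *; apply: (leaf_edge Nb Na).
have [eza|za] := eqVneq z a.
  by rewrite eza in zy rG' n2' ez *; rewrite edC; apply: (leaf_edge Na Nb).
have [ezb|zb] := eqVneq z b.
  by rewrite ezb in zy rG' n2' ez *; rewrite edC; apply: (leaf_edge Nb Na).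
rewrite !inE (negbTE ya) (negbTE yb) /= in yD; rewrite !inE (negbTE za) (negbTE zb) /= in zD.
have sG : fedges s \subset G by apply: fedges_sub.
apply: (subsetP sG); apply: IH => //; first by apply: rainbow_sub rG; apply: setUS.
by move=> e2; apply: n2; apply: missable2_sub e2.
Qed.

Lemma forest_flags s : forest s -> inner s = set0 -> all snd s.
Proof.
elim: s => [|[[[x a] b] f] s IH] //= /and5P[w _ _ _ _]; case: f => /=; first exact: IH.
by move/setP/(_ a); rewrite !inE eqxx.
Qed.

Lemma cons_free G col x a b s c : forest ((x, a, b, true) :: s) ->
  fedges ((x, a, b, true) :: s) \subset G -> rainbow_by col G ->
  [\/ c \notin col @: G, c = col (ed x a) | c = col (ed x b)] -> c \notin col @: fedges s.
Proof.
move=> /= /and5P[w abM ab aO /andP[bO xD]] sub [ci _] H.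
have xO : x \notin untouched s by apply: outer_untouched.
have xa : x != a by apply: contraNneq xO => ->.
have xb : x != b by apply: contraNneq xO => ->.
have /subsetP sub' := sub.
have xaG : ed x a \in G by apply: sub'; rewrite !inE eqxx orbT.
have xbG : ed x b \in G by apply: sub'; rewrite !inE eqxx.
have xas : ed x a \notin fedges s.
  by apply: contra xO; rewrite edC eq_sym in xa *; case/(untouched_edge w aO xa).
have xbs : ed x b \notin fedges s.
  by apply: contra xO; rewrite edC eq_sym in xb *; case/(untouched_edge w bO xb).
have sG e : e \in fedges s -> e \in G by move=> h; apply: sub'; rewrite !inE h !orbT.
apply/imsetP => -[e es ec]; case: H => [|h|h].
- by rewrite ec imset_f // sG.
- by rewrite h in ec; rewrite (ci _ _ xaG (sG e es) ec) es in xas.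
- by rewrite h in ec; rewrite (ci _ _ xbG (sG e es) ec) es in xbs.
Qed.

Lemma cons_edge G col x a b s c u v : forest ((x, a, b, true) :: s) -> all snd s ->
  fedges ((x, a, b, true) :: s) \subset G -> rainbow_by col G ->
  [\/ c \notin col @: G, c = col (ed x a) | c = col (ed x b)] ->
  u \in outer s -> v \in outer s -> u != v -> ed u v \in E c -> ~ missable2 G K u v ->
    ed u v \in G.
Proof.
move=> w fs sub r H uD vD uv uvc n2; have cs := cons_free w sub r H.
have sG : fedges s \subset G by apply: subset_trans (fedges_sub x a b true s) sub.
have /= /and5P[ws _ _ _ _] := w.
apply: (subsetP sG); apply: tower_edge => //.
  by exists (recol col (ed u v) c); apply: rainbow_by_add => //; apply: rainbow_by_sub r.
by move=> e2; apply: n2; apply: missable2_sub e2.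
Qed.

Lemma cons_leaf (G : {set {set T}}) x a b s : forest ((x, a, b, true) :: s) ->
  fedges ((x, a, b, true) :: s) \subset G ->
  (forall u v, v \in ed a b -> ed u v \in G -> ed u v \in fedges ((x, a, b, true) :: s)) ->
  leaf G x a b.
Proof.
move=> w sub nbr; have [Na Nb] := cons_nbr w.
have /subsetP sub' := sub; have /= /and5P[ws abM ab aO /andP[bO xD]] := w.
have xO : x \notin untouched s by apply: outer_untouched.
split; first by split=> //; apply: contraNneq xO => ->.
split; try by apply: sub'; rewrite !inE eqxx ?orbT.
- by apply: sub'; apply: (subsetP (M_sub _)).
- by move=> u ua uaG; apply: Na => //; apply: nbr; rewrite // !inE eqxx.
- by move=> u ub ubG; apply: Nb => //; apply: nbr; rewrite // !inE eqxx orbT.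
Qed.

Lemma no_two_tops x a b x2 a2 b2 s :
  let s1 := (x2, a2, b2, true) :: s in let s0 := (x, a, b, true) :: s1 in
  forest s0 -> all snd s -> rainbow (fedges s0) -> outer s0 = setT -> False.
Proof.
move=> s1 s0 w fs rG dT.
have fullG u : missable (fedges s0) K u by apply: missable_outer; rewrite // dT inE.
have cardG : #|fedges s0| <= 3 * K.
  have := card_fedges w; rewrite dT cardsT -(cardsC XM) cXM cM.
  by move: #|fedges s0| #|~: XM|; clear; lia.
have [w1 [abM ab aO bO xD]] : forest s1 /\ [/\ ed a b \in M, a != b, a \in untouched s1,
  b \in untouched s1 & x \in outer s1].
  by have /andP[? /and5P[]] := w.
have [w2 [abM2 ab2 aO2 bO2 xD2]] : forest s /\
    [/\ ed a2 b2 \in M, a2 != b2, a2 \in untouched s, b2 \in untouched s & x2 \in outer s].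
  by have /andP[? /and5P[]] := w1.
have d0 : outer s0 = a |: (b |: outer s1) by [].
have d1 : outer s1 = a2 |: (b2 |: outer s) by [].
have e0 e : e \in fedges s0 -> [\/ e = ed x a, true /\ e = ed x b | e \in fedges s1]
  by move/fedges_consP.
have sub1 : fedges s1 \subset fedges s0 by apply: (fedges_sub x a b true).
have fs1 : all snd s1 by [].
have l0 : leaf (fedges s0) x a b by apply: cons_leaf w (subxx _) _.
have edge1 := cons_edge w fs1 (subxx _).
have edge2 := cons_edge w1 fs sub1.
have [col r] := rG; have capG := cap rG.
have dO v : v \in outer s1 -> v != a /\ v != b.
  move=> /(outer_untouched w1) vO; split; first by apply: contraNneq vO => ->.
  by apply: contraNneq vO => ->.
have ed_ap u v : u != v -> ed u v \in fedges s0 ->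
  ~ missable2 (fedges s0) K u v by apply: edge_not_missable2.
have class_rest_ap x' a' b' u v : leaf (fedges s0) x' a' b' ->
  u \in class_rest (fedges s0) x' a' b' ->
    v \in class_rest (fedges s0) x' a' b' -> u != v -> ~ missable2 (fedges s0) K u v.
  move=> _ /class_restP[au _ _ _] /class_restP[av _ _ _] uv.
  by apply: (missable2_trans (v := a')) => // /missable2C.
have i0 : iso (fedges s0) x a b.
  split=> //; apply: (leaf_isolated fullG rG cardG l0 r) => c u v uP vP uv uvc hc.
  have inD q : q \in class_rest (fedges s0) x a b -> q \in outer s1.
    case/class_restP=> _ _ qa qb; have : q \in outer s0 by rewrite dT inE.
    by rewrite d0 !inE (negbTE qa) (negbTE qb).
  exact: (edge1 col c u v r hc (inD u uP) (inD v vP) uv uvc (class_rest_ap _ _ _ _ _ l0 uP vP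
    uv)).
have a2D : a2 \in outer s1 by rewrite d1 !inE eqxx.
have b2D : b2 \in outer s1 by rewrite d1 !inE eqxx orbT.
have [a2a a2b] := dO _ a2D; have [b2a b2b] := dO _ b2D.
have ab2G : ed a2 b2 \in fedges s0 by apply: (subsetP (M_sub s0)).
have [_ Nx] := i0.
have b2a2 : b2 != a2 by rewrite eq_sym.
have a2x : a2 != x.
  apply/eqP => e; rewrite e in b2a2 ab2G; rewrite edC in ab2G.
  by case: (Nx b2 b2a2 ab2G) => e'; rewrite e' eqxx in b2a b2b.
have b2x : b2 != x.
  apply/eqP => e; rewrite e in ab2 ab2G.
  by case: (Nx a2 ab2 ab2G) => e'; rewrite e' eqxx in a2a a2b.
have [[xa xb _] _] := l0.
have l2 : leaf (fedges s0) x2 a2 b2.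
  apply: cons_leaf w1 sub1 _ => u v vP /e0[h|[_ h]|//].
    by case: (ed_inj xa h) => -[_ e]; rewrite e !inE ?[_ == a2]eq_sym ?[_ == b2]eq_sym
      ?(negbTE a2a) ?(negbTE a2x) ?(negbTE b2a) ?(negbTE b2x) in vP.
  by case: (ed_inj xb h) => -[_ e]; rewrite e !inE ?[_ == a2]eq_sym ?[_ == b2]eq_sym
    ?(negbTE a2b) ?(negbTE a2x) ?(negbTE b2b) ?(negbTE b2x) in vP.
have ap_a q : ~ missable2 (fedges s0) K a2 q -> q != a /\ q != b.
  have n2 : a2 \notin [set a; b; x] by rewrite !inE (negbTE a2a) (negbTE a2b) (negbTE a2x).
  have n2' : a2 \notin [set b; x; a] by rewrite !inE (negbTE a2a) (negbTE a2b) (negbTE a2x).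
  move=> h; split; apply/eqP => e; apply: h; rewrite e; apply: missable2C.
    exact: iso_class fullG _ _ _ _ (iso_rot i0) n2.
  exact: iso_class fullG _ _ _ _ (iso_rot (iso_rot i0)) n2'.
have i2 : iso (fedges s0) x2 a2 b2.
  split=> //; apply: (leaf_isolated fullG rG cardG l2 r) => c u v uP vP uv uvc hc.
  have inD q : q \in class_rest (fedges s0) x2 a2 b2 -> q \in outer s.
    case/class_restP=> aq _ qa2 qb2; have [qa qb] := ap_a q aq.
    have : q \in outer s0 by rewrite dT inE.
    by rewrite d0 d1 !inE (negbTE qa) (negbTE qb) (negbTE qa2) (negbTE qb2).
  exact: (edge2 col c u v r hc (inD u uP) (inD v vP) uv uvc (class_rest_ap _ _ _ _ _ l2 uP vP
    uv)).
apply: (two_triangles fullG rG cardG r i0 i2).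
have x2D : x2 \in outer s1 by rewrite d1 !inE xD2 !orbT.
have [x2a x2b] := dO _ x2D.
have x2x : x2 != x.
  have [[[x2a2 _ _] [x2a2G _ _ _ _]] _] := i2.
  apply/eqP => e; rewrite e edC eq_sym in x2a2 x2a2G.
  by case: (Nx a2 x2a2 x2a2G) => e'; rewrite e' eqxx in a2a a2b.
rewrite disjoint_sym; apply/pred0P => q /=; rewrite !inE; apply/negbTE/negP => /andP[].
by move=> /orP[/orP[]|] /eqP-> /orP[/orP[]|]; apply/negP.
Qed.

Lemma no_full_forest s : forest s -> rainbow (fedges s) -> outer s = setT -> False.
Proof.
move=> w rG dT.
have fs : all snd s.
  apply: forest_flags => //; apply/setP => u; rewrite [RHS]inE; apply/negbTE/outer_inner => //.
  by rewrite dT inE.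
have cD : #|outer s| = #|~: XM| + K.*2 by rewrite dT cardsT -(cardsC XM) cXM addnC.
case: s w rG dT fs cD => [|[[[x a] b] f] [|[[[x2 a2] b2] f2] s]] w rG dT fs cD.
- by move: cD K_gt1; rewrite /=; move: #|_|; clear; lia.
- have : #|outer [:: (x, a, b, f)]| <= #|~: XM|.+2.
    rewrite /=; case: f {w rG dT fs cD}; last exact: leqW (cardU1_le _ _).
    by apply: leq_trans (cardU1_le _ _) _; rewrite ltnS cardU1_le.
  by move: K_gt1; rewrite cD; move: #|_|; clear; lia.
have /and3P[f1 f2' fs'] := fs; rewrite /= in f1 f2'.
rewrite f1 f2' in w rG dT; exact: no_two_tops w fs' rG dT.
Qed.
End Forest.
End Rainbow.

Lemma rainbow_matching (T C : finType) (E : C -> {set {set T}}) (K t : nat) :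
  1 < K -> #|C| = 3 * K + t ->
  (forall I : {set C}, t < #|I| ->
     exists X, pm (\bigcup_(c in I) E c) X /\ #|X| = K.+1.*2) ->
  exists G X, [/\ rainbow E G, pm G X & #|X| = K.+1.*2].
Proof.
move=> K1 cC coop; apply: contrapT => none.
have cap G : rainbow E G -> nu_le G K.
  move=> rG X p; rewrite leqNgt; apply/negP => lt; apply: none.
  have [|Y [pY cY]] := pm_trim (m := K.+1) p.
    by have := pm_even p; move: lt; move: #|_| => a; clear; lia.
  by exists G, Y.
have [M0 [X [rM pM cX]]] := exists_rainbow K1 cC coop (leqnn K).
have [M [sM pM' cM tM eM]] := pm_matching pM.
have cMK : #|M| = K by move: cM; rewrite cX => /double_inj.
have MX u v : u != v -> ed u v \in M -> u \in X.
  by move=> uv /eM[_ /subsetP/(_ u)]; rewrite !inE eqxx; apply.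
have mate u v w : u != v -> u != w -> ed u v \in M -> ed u w \in M -> v = w.
  move=> uv uw vM wM; have e : ed u v = ed u w.
    apply/eqP/negPn/negP => ne; have /trivIsetP/(_ _ _ vM wM ne)/pred0P/(_ u) := tM.
    by rewrite /= !inE eqxx.
  case: (ed_inj uw e) => -[// e1 e2]; by rewrite e1 eqxx in uw.
have [s [w rs ds]] := full_forest K1 cC coop cap pM' cX cMK MX mate (rainbow_sub sM rM).
exact: (no_full_forest K1 cC coop cap pM' cX cMK MX mate w rs ds).
Qed.

(** * Restriction to finitely many vertices *)

(* Imported only here because its lemma names shadow those of finset. *)
From mathcomp Require Import classical_sets.

Section Restriction.
Variables (V : choiceType) (W : {fset V}).

Definition fset_of (e : {set W}) : {fset V} := [fset val x | x in e]%fset.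

Lemma fset_ofE (e : {set W}) (x : W) : (val x \in fset_of e) = (x \in e).
Proof.
apply/imfsetP/idP => [[y ye /val_inj->//]|xe]; by exists x.
Qed.

Lemma card_fset_of (e : {set W}) : #|` fset_of e| = #|e|.
Proof. by rewrite /fset_of card_imfset /=; [rewrite cardE|apply: val_inj]. Qed.

Lemma fset_of_inj : injective fset_of.
Proof. by move=> e f h; apply/setP => x; rewrite -!fset_ofE h. Qed.

Lemma disjoint_fset_of (e f : {set W}) : [disjoint fset_of e & fset_of f]%fset = [disjoint e & f].
Proof.
apply/fdisjointP/pred0P => [h x /=|h _ /imfsetP[x xe ->]].
  by apply/negbTE/negP => /andP[]; rewrite -!fset_ofE => /h/negP.
by rewrite fset_ofE; have /= := h x; rewrite xe => /= ->.
Qed.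

Lemma fset_of_sub (e : {fset V}) : (e `<=` W)%fset -> exists f, fset_of f = e.
Proof.
move=> /fsubsetP sW; exists [set x | val x \in e]; apply/fsetP => v.
apply/imfsetP/idP => [[x + ->]|ve]; first by rewrite inE.
by exists [` sW v ve]%fset => //; rewrite inE.
Qed.
End Restriction.

Theorem theorem4p3 (t n : nat) (hn : 3 <= n) (V : choiceType) (G : graph V)
    (E : 'I_(3 * n - 3 + t) -> set {fset V})
    (hE : forall i, (E i `<=` edges G)%classic)
    (hmatch : forall I : {set 'I_(3 * n - 3 + t)}, #|I| = t + 1 ->
       contains_matching G (\bigcup_(i in [set` I]) E i)%classic n) :
  has_rainbow_matching G E n.
Proof.
have nE : n = n.-1.+1 by rewrite prednK //; apply: leq_trans hn.
have hA (I : {set 'I_(3 * n - 3 + t)}) : exists M, #|I| = t + 1 ->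
    [/\ is_matching G M, #|` M| = n &
        forall e, e \in M -> (\bigcup_(i in [set` I]) E i)%classic e].
  have [cI|cI] := eqVneq #|I| (t + 1); last by exists fset0 => e; rewrite e eqxx in cI.
  by have [M hM] := hmatch I cI; exists M.
have {hA}[A hA] := choice hA.
pose W : {fset V} := (\bigcup_(I <- enum {: {set 'I_(3 * n - 3 + t)}}) \bigcup_(e <- A I) e)%fset.
have sW I e : e \in A I -> (e `<=` W)%fset.
  move=> eA; apply/fsubsetP => v ve; apply/bigfcupP; exists I; first by rewrite mem_enum.
  by apply/bigfcupP; exists e; rewrite ?eA.
pose E' c : {set {set W}} := [set e | `[< E c (fset_of e) >]].
have [||I tI|G' [X [[col [ci ce]] pX cX]]] := @rainbow_matching W 'I_(3 * n - 3 + t) E' n.-1 t.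
- by rewrite -ltnS -nE.
- by rewrite card_ord nE; lia.
- pose I0 := [set x in take (t + 1) (enum I)].
  have sI : I0 \subset I.
    by apply/fintype.subsetP => x; rewrite inE => /mem_take; rewrite mem_enum.
  have cI : #|I0| = t + 1.
    rewrite cardsE (card_uniqP _) ?take_uniq ?enum_uniq // size_takel //.
    by rewrite -cardE addn1.
  have [[MG Md] cM eM] := hA I0 cI.
  pose M := [set e : {set W} | fset_of e \in A I0].
  have eAM : A I0 = [fset fset_of e | e in M]%fset.
    apply/fsetP => e; apply/idP/imfsetP => [eA|[f + ->]]; last by rewrite inE.
    by have [f ef] := fset_of_sub (sW I0 e eA); exists f; rewrite //= inE ef.
  have [||e|pM cXM] := @matching_pm W (\bigcup_(c in I) E' c) M.
  + apply/fintype.subsetP => e; rewrite inE => /eM[c cI0 ec]; apply/finset.bigcupP; exists c.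
      exact: (fintype.subsetP sI).
    by rewrite inE; apply/asboolP.
  + apply/finset.trivIsetP => e f; rewrite !inE => eA fA ef; rewrite -disjoint_fset_of.
    by apply: Md => //; apply: contraNneq ef => /fset_of_inj->.
  + by rewrite inE => /MG/card_edge; rewrite card_fset_of.
  exists (finset.cover M); split=> //; rewrite cXM -nE -cM; congr _.*2.
  by rewrite eAM card_imfset /= -?cardE //; apply: fset_of_inj.
have [M [sM pM cM tM eM]] := pm_matching pX.
have cMn : #|M| = n by rewrite nE; apply: double_inj; rewrite cM.
have MG e : e \in M -> e \in G' by move/(fintype.subsetP sM).
pose g (j : 'I_n) : {set W} := enum_val (cast_ord (esym cMn) j).
have gM j : g j \in M by apply: enum_valP.
have gi : injective g by move=> j k /enum_val_inj/cast_ord_inj.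
exists (col \o g), (fun j => fset_of (g j)); split.
- by move=> j k /(ci _ _ (MG _ (gM j)) (MG _ (gM k)))/gi.
- by move=> j; have := ce _ (MG _ (gM j)); rewrite inE => /asboolP.
- split=> [_ /imfsetP[j _ ->]|_ _ /imfsetP[j _ ->] /imfsetP[k _ ->] ne].
    by apply: hE; have := ce _ (MG _ (gM j)); rewrite inE => /asboolP; apply.
  rewrite disjoint_fset_of; move/finset.trivIsetP: tM; apply=> //.
  by apply: contraNneq ne => ->.
- by rewrite card_imfset /= ?size_enum_ord // => j k /fset_of_inj/gi.
Qed.
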